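(* Let $n\in\{2,3\}$, and let $d_i=\|a_i-x^o\|+r_i$, $i=1,2,\ldots$, be range measurements of an object at $x^o\in\mathbb R^n$ by sensors at $a_i\in\mathbb R^n$, satisfying assumptions (A1), (A2), (A3), (A6) of the context, with known noise variance $\sigma^2$. For each $m$ let $\hat x^{\rm BE}_m$ be a random vector that is an optimal solution (the Bias-Eli estimate) of $$\mathop{\rm minimize}_{x\in\mathbb R^n}\ \sum_{i=1}^m\left(\|a_i-x\|^2-d_i^2+\sigma^2\right)^2 .$$ Then the Bias-Eli estimator is $\sqrt m$-consistent, i.e. $\hat x^{\rm BE}_m-x^o=O_p(1/\sqrt m)$.
   Context: $X_m=O_p(\alpha_m)$ means that $X_m/\alpha_m$ is stochastically bounded: for every $\epsilon>0$ there exist finite $M,N$ such that $P(|X_m/\alpha_m|>N)<\epsilon$ for all $m>M$ (with the norm in place of the absolute value for vectors). The sample distribution function of a sequence $(z_1,z_2,\ldots)$ in $\mathbb R^n$ is $F_m(z)=\#\{i\le m: z_i\preceq z\}/m$, where $\preceq$ is the coordinatewise inequality. Assumptions. (A1) The $r_i$ are i.i.d. Gaussian with mean $0$ and finite variance $\sigma^2$. (A2) $x^o$ is an interior point of a compact set $\mathcal X\subset\mathbb R^n$; all the (deterministic) sensor positions $a_i$ lie in a bounded set $\mathcal A\subset\mathbb R^n$, and $a_i\notin\mathcal X$ for each $i$. (A3) The sample distribution function $F_m$ of $(a_1,a_2,\ldots)$ converges to a distribution function $F_\mu$, i.e. $F_m(a)\to F_\mu(a)$ at every continuity point $a\in\mathbb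 R^n$ of $F_\mu$; $\mu$ denotes the probability measure generated by $F_\mu$. (A6) There is no (affine) line $\mathcal S$ (if $n=2$), respectively plane $\mathcal S$ (if $n=3$), such that $\mu(\mathcal S)=1$. *)

(* Defs.v *)
From HB Require Import structures.
From mathcomp Require Import all_boot all_order all_algebra.
From mathcomp Require Import all_classical all_reals all_analysis.

Set Implicit Arguments.
Unset Strict Implicit.
Unset Printing Implicit Defensive.

Import Order.TTheory GRing.Theory Num.Theory.
Import numFieldNormedType.Exports.

Local Open Scope classical_set_scope.
Local Open Scope ring_scope.

(* The Borel sigma-algebra of R^n, generated by the open sets. *)
Notation borelRV R n := (g_sigma_algebraType (@open 'rV[R]_n)).

(* The library norm `|x| on 'rV[R]_n is the sup norm; it induces the same
   topology and the same bounded sets as this one. *)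
Definition enorm (R : realType) (n : nat) (x : 'rV[R]_n) : R :=
  Num.sqrt (\sum_(j < n) x 0 j ^+ 2).

Definition coord_le (R : realType) (n : nat) (x y : 'rV[R]_n) : bool :=
  [forall j, x 0 j <= y 0 j].

(* Sequences are indexed from 0: the first m terms are a 0, ..., a m.-1. *)
Definition sample_df (R : realType) (n : nat) (a : nat -> 'rV[R]_n) (m : nat)
    (z : 'rV[R]_n) : R :=
  #|[pred i : 'I_m | coord_le (a i) z]|%:R / m%:R.

Definition dist_fun (R : realType) (n : nat)
    (mu : probability (borelRV R n) R) (z : 'rV[R]_n) : R :=
  fine (mu [set y | coord_le y z]).

(* S = p + (row space of U), with a direction space of dimension k. *)
Definition affine_flat (R : realType) (n k : nat) (S : set 'rV[R]_n) : Prop :=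
  exists (p : 'rV[R]_n) (U : 'M[R]_n),
    \rank U = k /\ S = [set z | (z - p <= U)%MS].

(* The law N(m, s^2). The library's normal_prob m 0 is by convention the
   uniform law on [0, 1], whereas N(m, 0) is the point mass at m. *)
Definition gaussian (R : realType) (m s : R) (B : set R) : \bar R :=
  if s == 0 then \d_m B else normal_prob m s B.

Definition mutually_independent (R : realType) (d : measure_display)
    (T : measurableType d) (P : probability T R)
    (X : nat -> {RV P >-> R}) : Prop :=
  forall (J : seq nat) (B : nat -> set R), uniq J ->
    (forall i, measurable (B i)) ->
    P (\bigcap_(i in [set` J]) (X i @^-1` B i)) =
    (\prod_(i <- J) P (X i @^-1` B i))%E.

Definition iid_gaussian (R : realType) (d : measure_display)
    (T : measurableType d) (P : probability T R)
    (X : nat -> {RV P >-> R}) (m s : R) : Prop :=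
  mutually_independent X /\
  forall (i : nat) (B : set R), measurable B ->
    distribution P (X i) B = gaussian m s B.

(* X_m = O_p(alpha_m). *)
Definition bigO_p (R : realType) (d : measure_display)
    (T : measurableType d) (P : probability T R) (n : nat)
    (X : nat -> T -> 'rV[R]_n) (alpha : nat -> R) : Prop :=
  forall eps : R, 0 < eps ->
    exists (M : nat) (N : R), forall m : nat, (M < m)%N ->
      (P [set w | (N < enorm ((alpha m)^-1 *: X m w))%R] < eps%:E)%E.

(* Here s is the noise standard deviation, so s ^+ 2 is the variance. *)
Definition be_cost (R : realType) (n : nat) (a : nat -> 'rV[R]_n)
    (d : nat -> R) (s : R) (m : nat) (x : 'rV[R]_n) : R :=
  \sum_(i < m) (enorm (a i - x) ^+ 2 - d i ^+ 2 + s ^+ 2) ^+ 2.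

(* Main.v *)
(* Put h = x - xo, e_i = a_i - xo, v_i = (1, e_i) and u = (|h|^2, -2 h). The
   i-th residual of the cost at x is u.v_i - eta_i with
   eta_i = 2 |e_i| r_i + r_i^2 - sigma^2, and at xo it is - eta_i. Minimality
   therefore gives sum (u.v_i)^2 <= 2 u.W with W = sum eta_i v_i. If
   sum (u.v_i)^2 >= k m |u|^2 for large m, this forces
   4 |h|^2 <= |u|^2 <= 4 |W|^2 / (k m)^2. The eta_i are centred, pairwise
   uncorrelated and of bounded variance, so E |W|^2 = O(m), and Markov's
   inequality concludes.
   For the lower bound, by compactness of the unit sphere it suffices to find,
   for each u <> 0, some e > 0 such that a positive fraction of the sensors
   satisfies |u.v_i| >= e. The set {u.v > e} is open and, by (A6), charged by mu
   for some e; hence it contains a half-open box charged by mu whose corners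
   avoid the atoms of the marginals of mu. The distribution function is
   continuous at such corners, and (A3) with inclusion-exclusion shows that the
   fraction of sensors in the box converges to its mu-measure. *)
Require Import Defs.
From HB Require Import structures.
From mathcomp Require Import all_boot all_order all_algebra.
From mathcomp Require Import all_classical all_reals all_analysis.
From mathcomp Require Import measurable_realfun ring lra.

Set Implicit Arguments.
Unset Strict Implicit.
Unset Printing Implicit Defensive.

Import Order.TTheory GRing.Theory Num.Theory.
Import numFieldNormedType.Exports.

Local Open Scope classical_set_scope.
Local Open Scope ring_scope.

(** * Moments of the normal law *)

Section gaussian_moments.
Context {R : realType}.
Let lam := @lebesgue_measure R.

(** The Radon-Nikodym derivative of the law with respect to Lebesgue measure and [normal_pdf] have
    the same integral over every measurable set, hence agree almost everywhere. *)
Lemma ge0_integral_normal_prob (m s : R) (f : measurableTypeR R -> \bar R) :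
    (forall x, (0 <= f x)%E) -> measurable_fun setT f ->
  (\int[normal_prob m s]_x f x = \int[lam]_x (f x * (normal_pdf m s x)%:E))%E.
Proof.
move=> f0 mf.
have dom := @normal_prob_dominates R m s.
rewrite -(Radon_Nikodym_SigmaFinite.change_of_variables dom)//.
have mpdf : measurable_fun setT (fun x => (normal_pdf m s x)%:E).
  by apply/measurable_EFinP; exact: measurable_normal_pdf.
have intRN := Radon_Nikodym_SigmaFinite.f_integrable dom.
have mRN := measurable_int _ intRN.
apply: ae_eq_integral => //; [exact: emeasurable_funM|exact: emeasurable_funM|].
apply: ae_eqe_mul2l; apply: integral_ae_eq => // A _ mA.
by rewrite -Radon_Nikodym_SigmaFinite.f_integral.
Qed.

Lemma is_derive_normal_fun0 (s x : R) : s != 0 ->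
  is_derive x 1 (normal_fun 0 s) (- x / s ^+ 2 * normal_fun 0 s x).
Proof.
move=> s0.
have -> : normal_fun 0 s = expR \o (fun x => - x ^+ 2 * (s ^+ 2 *+ 2)^-1).
  by apply/funext => y; rewrite /normal_fun subr0.
apply: is_derive_eq.
rewrite /= !scaler0 ?add0r ?addr0 /GRing.scale/=.
by set e := expR _; rewrite -(mulr_natr (s ^+ 2)); field.
Qed.

Lemma continuous_of_is_derive (f f' : R -> R) :
  (forall x : R, is_derive x 1 f (f' x)) -> continuous f.
Proof.
move=> df x; apply: differentiable_continuous; apply/derivable1_diffP.
exact: ex_derive.
Qed.

Lemma ge0_integral0y_derive (f F : R -> R) (l : R) :
    (forall x, 0 <= x -> 0 <= f x) -> continuous f ->
    (forall x : R, is_derive x 1 F (f x)) -> F x @[x --> +oo] --> l ->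
  (\int[lam]_(x in `[0%R, +oo[) (f x)%:E = l%:E - (F 0)%:E)%E.
Proof.
move=> f0 cf dF Fl; apply: ge0_continuous_FTC2y => //.
- exact: continuous_subspaceT.
- by apply: cvg_at_right_filter; exact: continuous_of_is_derive dF _.
- by move=> x _; rewrite derive1E; exact: derive_val.
Qed.

Lemma cvg_expRNM (s : R) : 0 < s -> expR (- (x / s)) @[x --> +oo] --> (0 : R).
Proof.
move=> s0; apply: (@cvg_comp _ _ _ (fun x => x / s) (fun y => expR (- y))).
  by apply: gt0_cvgMly; rewrite ?invr_gt0//; exact: cvg_id.
exact: cvgr_expR.
Qed.

(** With y = x^2 / (2 s^2), the inequality exp y >= 1 + y >= y bounds the product by 2 s^2 / x. *)
Lemma cvg_id_normal_fun (s : R) : 0 < s ->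
  x * normal_fun 0 s x @[x --> +oo] --> (0 : R).
Proof.
move=> s0; apply: (@squeeze_cvgr _ _ _ _ (cst 0) (fun x => 2 * s ^+ 2 * x^-1)).
- near=> x.
  have x0 : 0 < x by [].
  rewrite mulr_ge0 ?normal_fun_ge0 ?(ltW x0)//= /normal_fun subr0 mulNr expRN.
  set y := x ^+ 2 / _.
  have -> : 2 * s ^+ 2 * x^-1 = x * y^-1.
    by rewrite /y -(mulr_natr (s ^+ 2)); field; rewrite !gt_eqF.
  have y0 : 0 < y by rewrite divr_gt0 ?mulrn_wgt0 ?exprn_gt0.
  rewrite ler_pM2l// lef_pV2 ?posrE ?expR_gt0//.
  by rewrite (le_trans _ (expR_ge1Dx _))// lerDr.
- exact: cvg_cst.
- rewrite -[X in _ --> X](mulr0 (2 * s ^+ 2)).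
  apply: cvgM; first exact: cvg_cst.
  by apply/gtr0_cvgV0; [near=> x|exact: cvg_id].
Unshelve. all: by end_near. Qed.

(** Integration by parts: with g the unnormalised density, (x^2 - s^2) g is the derivative of - s^2
    x g, which vanishes at 0 and at infinity. *)
Lemma integral0y_sqr_normal_fun (s : R) : 0 < s ->
  (\int[lam]_(x in `[0%R, +oo[) (x ^+ 2 * normal_fun 0 s x)%:E =
   (s ^+ 2)%:E * \int[lam]_(x in `[0%R, +oo[) (normal_fun 0 s x)%:E)%E.
Proof.
move=> s0; have s_neq0 := lt0r_neq0 s0.
(* The summand [e] makes [f] non-negative, as the improper FTC requires. *)
pose e (x : R) := 3 * s ^+ 2 * expR (- (x / s)).
pose f (x : R) := (x ^+ 2 - s ^+ 2) * normal_fun 0 s x + e x.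
have dg x := is_derive_normal_fun0 x s_neq0.
have cg : continuous (normal_fun 0 s) := continuous_of_is_derive dg.
have de (x : R) : is_derive x 1 (fun y => expR (- (y / s)))
    (- s^-1 * expR (- (x / s))).
  by apply: is_derive_eq; rewrite /GRing.scale/=; ring.
have ce : continuous e.
  by move=> x; apply: cvgM; [exact: cvg_cst|exact: (continuous_of_is_derive de)].
have cx2 : continuous (fun x : R => x ^+ 2) by exact: exprn_continuous.
have mD : measurable (`[0%R, +oo[%classic : set (measurableTypeR R)) by [].
have mC (h : R -> R) : continuous h ->
    measurable_fun (`[0%R, +oo[%classic : set (measurableTypeR R)) (EFin \o h).
  move=> ch; apply: measurable_funTS; apply/measurable_EFinP.
  exact: continuous_measurable_fun.
have f_ge0 x : 0 <= x -> 0 <= f x.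
  move=> x0; set u := x / s.
  (* The constant 3 in [e] pays for the only negative term, - exp (u - u^2/2): this exponential is
     at most 3 because u - u^2/2 <= 1/2. *)
  have -> : f x = s ^+ 2 * expR (- u) * ((u ^+ 2 - 1) * expR (u - u ^+ 2 / 2) + 3).
    have E : expR (- u) * expR (u - u ^+ 2 / 2) = normal_fun 0 s x.
      rewrite -expRD; congr expR.
      by rewrite subr0 -(mulr_natr (s ^+ 2)) /u; field.
    by rewrite /f /e -E -/u /u; set g := expR _; set h := expR _; field.
  apply: mulr_ge0; first by rewrite mulr_ge0 ?expR_ge0 ?sqr_ge0.
  have g0 : 0 <= expR (u - u ^+ 2 / 2) by exact: expR_ge0.
  have g3 : expR (u - u ^+ 2 / 2) <= 3.
    have t_le : u - u ^+ 2 / 2 <= 2^-1 by have := sqr_ge0 (u - 1); lra.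
    have := expRxMexpNx_1 (u - u ^+ 2 / 2).
    have := expR_ge1Dx (- (u - u ^+ 2 / 2)).
    by set g := expR _ in g0 *; set h := expR _ => h1 gh; nra.
  have := mulr_ge0 (sqr_ge0 u) g0; lra.
have cf : continuous f.
  move=> x; apply: cvgD; last exact: ce.
  by apply: cvgM; [apply: cvgB; [exact: cx2|exact: cvg_cst]|exact: cg].
pose E (x : R) := - (3 * s ^+ 3) * expR (- (x / s)).
have dE (x : R) : is_derive x 1 E (e x).
  by apply: is_derive_eq; rewrite /e /GRing.scale/=; set h := expR _; field.
have E_cvg : E x @[x --> +oo] --> (0 : R).
  rewrite -[X in _ --> X](mulr0 (- (3 * s ^+ 3))).
  by apply: cvgM; [exact: cvg_cst|exact: cvg_expRNM].
have E0 : E 0 = - (3 * s ^+ 3) by rewrite /E mul0r oppr0 expR0 mulr1.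
have inte : (\int[lam]_(x in `[0%R, +oo[) (e x)%:E = (3 * s ^+ 3)%:E)%E.
  have e_ge0 x : 0 <= x -> 0 <= e x.
    by move=> _; rewrite /e mulr_ge0 ?expR_ge0// mulr_ge0 ?sqr_ge0.
  by rewrite (ge0_integral0y_derive e_ge0 ce dE E_cvg) E0 EFinN oppeK add0e.
have intf : (\int[lam]_(x in `[0%R, +oo[) (f x)%:E = (3 * s ^+ 3)%:E)%E.
  pose F (x : R) := - s ^+ 2 * (x * normal_fun 0 s x) + E x.
  have dF (x : R) : is_derive x 1 F (f x).
    have dxg : is_derive x 1 (fun y => y * normal_fun 0 s y)
        (normal_fun 0 s x - x ^+ 2 / s ^+ 2 * normal_fun 0 s x).
      apply: (is_derive_eq (is_deriveM (is_derive_id x 1) (dg x))).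
      by rewrite /GRing.scale/=; field.
    apply: (is_derive_eq (is_deriveD (is_deriveZ (- s ^+ 2) dxg) (dE x))).
    by rewrite /f /GRing.scale/=; field.
  have F_cvg : F x @[x --> +oo] --> (0 : R).
    rewrite -[X in _ --> X](addr0 0); apply: cvgD => //.
    rewrite -[X in _ --> X](mulr0 (- s ^+ 2)).
    by apply: cvgM; [exact: cvg_cst|exact: cvg_id_normal_fun].
  rewrite (ge0_integral0y_derive f_ge0 cf dF F_cvg) /F E0 mul0r mulr0 add0r.
  by rewrite sub0r EFinN oppeK.
(* The functions f + s^2 g and x^2 g + e coincide; as f and e both integrate to 3 s^3, these finite
   terms cancel. *)
have : (\int[lam]_(x in `[0%R, +oo[) ((f x)%:E + (s ^+ 2 * normal_fun 0 s x)%:E) =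
        \int[lam]_(x in `[0%R, +oo[) ((x ^+ 2 * normal_fun 0 s x)%:E + (e x)%:E))%E.
  apply: eq_integral => x _; rewrite -!EFinD /f; congr EFin; ring.
have g_ge0 x : 0 <= normal_fun 0 s x := normal_fun_ge0 0 s x.
rewrite ge0_integralD//; last 4 first.
- by move=> x /=; rewrite in_itv/= andbT => x0; rewrite lee_fin f_ge0.
- exact: mC.
- by move=> x _; rewrite lee_fin mulr_ge0 ?sqr_ge0.
- by apply: mC => x; apply: cvgM; [exact: cvg_cst|exact: cg].
rewrite ge0_integralD//; last 4 first.
- by move=> x _; rewrite lee_fin mulr_ge0 ?sqr_ge0.
- by apply: mC => x; apply: cvgM; [exact: cx2|exact: cg].
- by move=> x _; rewrite lee_fin /e mulr_ge0 ?expR_ge0// mulr_ge0 ?sqr_ge0.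
- exact: mC.
rewrite intf inte addeC => /(congr1 (fun z => z - (3 * s ^+ 3)%:E)%E).
rewrite !addeK// => <-.
under eq_integral do rewrite EFinM.
rewrite ge0_integralZl_EFin ?sqr_ge0//; last exact: mC.
by move=> x _; rewrite lee_fin.
Qed.

(** Splitting the line at 0 and reflecting the negative half gives an expression that is symmetric
    in a function and its reflection. *)
Lemma ge0_integralTN (f : R -> R) : (forall x, 0 <= f x) -> continuous f ->
  (\int[lam]_x (f x)%:E = \int[lam]_x (f (- x))%:E)%E.
Proof.
move=> f0 cf.
have split (h : R -> R) : (forall x, 0 <= h x) -> continuous h ->
    (\int[lam]_x (h x)%:E = \int[lam]_(x in `[0%R, +oo[) (h x)%:E +
      \int[lam]_(x in `[0%R, +oo[) (h (- x))%:E)%E.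
  move=> h0 ch.
  have mh : measurable_fun [set: R] h by exact: continuous_measurable_fun.
  rewrite -(setUv (`[0%R, +oo[%classic : set (measurableTypeR R))).
  rewrite ge0_integral_setU//=; last 4 first.
  - exact: measurableC.
  - by apply/measurable_EFinP; rewrite setUv.
  - by move=> x _; rewrite lee_fin.
  - exact/disj_setPCl.
  congr (_ + _)%E; rewrite setCitvr integral_itv_bndo_bndc; last first.
    exact/measurable_EFinP/measurable_funTS.
  rewrite -{1}oppr0 ge0_integration_by_substitutionNy//.
  exact: continuous_subspaceT.
rewrite (split f)// (split (f \o -%R))//=.
  by rewrite addeC; congr (_ + _)%E; apply: eq_integral => x _; rewrite opprK.
by move=> x; apply: continuous_comp; [exact: oppr_continuous|exact: cf].
Qed.

Lemma normal_pdfN (s x : R) : s != 0 ->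
  normal_pdf 0 s (- x) = normal_pdf 0 s x.
Proof. by move=> s0; rewrite !normal_pdfE// /normal_fun !subr0 sqrrN. Qed.

(** Evenness reduces both the second moment and the total mass 1 to the half-line, where
    [integral0y_sqr_normal_fun] compares them; the normalising constant is carried along on both
    sides. *)
Lemma normal_moment2 (s : R) : 0 < s ->
  (\int[normal_prob 0 s]_x (x ^+ 2)%:E = (s ^+ 2)%:E)%E.
Proof.
move=> s0; have s_neq0 := lt0r_neq0 s0.
have cpdf : continuous (normal_pdf 0 s) := @continuous_normal_pdf R 0 s s_neq0.
have cx2 : continuous (fun x : R => x ^+ 2) by exact: exprn_continuous.
have even x := normal_pdfN x s_neq0.
rewrite ge0_integral_normal_prob//; last 2 first.
- by move=> x; rewrite lee_fin sqr_ge0.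
- by apply/measurable_EFinP; exact: continuous_measurable_fun.
under eq_integral do rewrite -EFinM.
rewrite ge0_symfun_integralT; last 3 first.
- by move=> x; rewrite mulr_ge0 ?sqr_ge0 ?normal_pdf_ge0.
- by move=> x; apply: cvgM; [exact: cx2|exact: cpdf].
- by move=> x /=; rewrite sqrrN even.
have /esym := integral_normal_pdf 0 s.
rewrite ge0_symfun_integralT//; last 2 first.
- exact: normal_pdf_ge0.
- by move=> x /=; rewrite even.
rewrite -!set_itvcy => intpdf.
rewrite -[RHS]mule1 intpdf muleCA; congr (_ * _)%E.
have mg : measurable_fun (`[0%R, +oo[%classic : set (measurableTypeR R))
    (fun x => (x ^+ 2 * normal_fun 0 s x)%:E).
  apply: measurable_funTS; apply/measurable_EFinP/measurable_funM => //.
    exact: measurable_normal_fun.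
under [LHS]eq_integral do rewrite normal_pdfE// mulrCA EFinM.
rewrite ge0_integralZl_EFin//; last 2 first.
- by move=> x _; rewrite lee_fin mulr_ge0 ?sqr_ge0 ?normal_fun_ge0.
- exact: normal_peak_ge0.
under [in RHS]eq_integral do rewrite normal_pdfE// EFinM.
rewrite ge0_integralZl_EFin//; last 3 first.
- by move=> x _; rewrite lee_fin normal_fun_ge0.
- by apply: measurable_funTS; apply/measurable_EFinP; exact: measurable_normal_fun.
- exact: normal_peak_ge0.
by rewrite integral0y_sqr_normal_fun// muleCA.
Qed.

(** Doubling the variance absorbs the power of x: x^4 times the density of standard deviation s is
    at most C times that of standard deviation t = sqrt 2 s. *)
Lemma normal_moment4_lty (s : R) : 0 < s ->
  (\int[normal_prob 0 s]_x (x ^+ 4)%:E < +oo)%E.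
Proof.
move=> s0; have s_neq0 := lt0r_neq0 s0.
pose t := Num.sqrt 2 * s.
have t_gt0 : 0 < t by rewrite mulr_gt0// sqrtr_gt0.
have t_neq0 := lt0r_neq0 t_gt0.
(* In terms of y = x^2 / (4 s^2), the two densities decay like exp (-2y) and exp (-y), and x^4 = 16
   s^4 y^2. Since y^2 exp (-y) <= 4, the factor 64 s^4 suffices, up to the ratio of the peaks. *)
pose C := 64 * s ^+ 4 * normal_peak s / normal_peak t.
have C0 : 0 <= C.
  apply: divr_ge0; last exact: normal_peak_ge0.
  apply: mulr_ge0; last exact: normal_peak_ge0.
  by rewrite mulr_ge0// exprn_ge0// ltW.
rewrite ge0_integral_normal_prob; last 2 first.
- by move=> x; rewrite lee_fin (exprM x 2 2) sqr_ge0.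
- by apply/measurable_EFinP; exact: measurable_funX.
apply: (@le_lt_trans _ _ (\int[lebesgue_measure]_x (C%:E * (normal_pdf 0 t x)%:E))%E).
  apply: ge0_le_integral => //.
  - by move=> x _; rewrite lee_fin mulr_ge0 ?normal_pdf_ge0// (exprM x 2 2) sqr_ge0.
  - apply/measurable_EFinP/measurable_funM; first exact: measurable_funX.
    exact: measurable_normal_pdf.
  - apply/measurable_EFinP/measurable_funM => //; exact: measurable_normal_pdf.
  move=> x _; rewrite -!EFinM lee_fin !normal_pdfE//.
  have -> : C * (normal_peak t * normal_fun 0 t x) =
      normal_peak s * (64 * s ^+ 4 * normal_fun 0 t x).
    by rewrite /C; field; rewrite gt_eqF ?normal_peak_gt0.
  rewrite mulrCA.
  rewrite ler_wpM2l ?normal_peak_ge0// /normal_fun subr0.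
  pose y := x ^+ 2 / (4 * s ^+ 2).
  have -> : - x ^+ 2 / (s ^+ 2 *+ 2) = - y - y.
    by rewrite /y -mulr_natr; field.
  have -> : - x ^+ 2 / (t ^+ 2 *+ 2) = - y.
    by rewrite /y /t -mulr_natr exprMn sqr_sqrtr//; field.
  have y0 : 0 <= y by rewrite divr_ge0 ?sqr_ge0// mulr_ge0 ?sqr_ge0.
  have -> : x ^+ 4 = 16 * s ^+ 4 * y ^+ 2 by rewrite /y; field.
  have ey : y ^+ 2 * expR (- y) <= 4.
    have := expR_ge1Dx (y / 2); have := expRxMexpNx_1 y.
    have -> : expR y = expR (y / 2) ^+ 2 by rewrite -expRM_natl; congr expR; field.
    have := expR_ge0 (- y); set g := expR (- y); set h := expR (y / 2).
    move=> g0 gh h1.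
    have h2 : 0 <= (h - y / 2) * (h + y / 2) by apply: mulr_ge0; lra.
    nra.
  rewrite expRD; set g := expR (- y) in ey *.
  have g0 : 0 <= g by exact: expR_ge0.
  have s4 : 0 <= s ^+ 4 by rewrite exprn_ge0 ?ltW.
  have -> : 16 * s ^+ 4 * y ^+ 2 * (g * g) = 16 * (s ^+ 4 * g) * (y ^+ 2 * g) by ring.
  have -> : 64 * s ^+ 4 * g = 16 * (s ^+ 4 * g) * 4 by ring.
  by rewrite ler_wpM2l// mulr_ge0// mulr_ge0.
rewrite ge0_integralZl_EFin//.
- by rewrite integral_normal_pdf mule1 ltry.
- by move=> x _; rewrite lee_fin normal_pdf_ge0.
- by apply/measurable_EFinP; exact: measurable_normal_pdf.
Qed.

End gaussian_moments.

(** * Moments and symmetry of a centred Gaussian variable *)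

Section gaussian_random_variable.
Context {R : realType} d (T : measurableType d) (P : probability T R).
Variables (X : {RV P >-> R}) (s : R).
Hypothesis s_ge0 : 0 <= s.
Hypothesis X_gauss : forall B : set R, measurable B ->
  distribution P X B = gaussian 0 s B.

Lemma ge0_integral_gaussian_dirac (f : R -> \bar R) : s = 0 ->
    (forall x, (0 <= f x)%E) -> measurable_fun setT f ->
  (\int[P]_w f (X w) = f 0%R)%E.
Proof.
move=> s0 f0 mf; rewrite -(ge0_integral_distribution X mf f0).
rewrite (eq_measure_integral (dirac (0 : R))); last first.
  by move=> A mA _; rewrite [LHS]X_gauss// /gaussian s0 eqxx.
by rewrite integral_dirac// diracT mul1e.
Qed.

(* [R] and [measurableTypeR R] have the same measurable sets but different
   displays: [X] has to be pushed forward to the type that carries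
   [normal_prob]. *)
Lemma ge0_integral_gaussian_normal (f : R -> \bar R) : 0 < s ->
    (forall x, (0 <= f x)%E) -> measurable_fun setT f ->
  (\int[P]_w f (X w) = \int[normal_prob 0 s]_x f x)%E.
Proof.
move=> s0 f0 mf.
have mX : measurable_fun setT (X : T -> measurableTypeR R).
  exact: (measurable_funPT X).
pose Y : {mfun T >-> measurableTypeR R} := MeasurableFun.Pack
  (MeasurableFun.Class (isMeasurableFun.Build _ _ _ _ _ mX)).
have mf' : measurable_fun setT (f : measurableTypeR R -> \bar R) by exact: mf.
have <- := ge0_integral_distribution (P := P) Y mf' f0.
apply: eq_measure_integral => A mA _.
rewrite [LHS](X_gauss (B := A)) ?/gaussian ?gt_eqF//.
Qed.

Lemma gaussian_moment2 : (\int[P]_w (X w ^+ 2)%:E = (s ^+ 2)%:E)%E.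
Proof.
have mf : measurable_fun [set: R] (fun x : R => (x ^+ 2)%:E).
  by apply/measurable_EFinP; exact: measurable_funX.
have f0 (x : R) : (0 <= (x ^+ 2)%:E)%E by rewrite lee_fin sqr_ge0.
move: s_ge0; rewrite le_eqVlt => /predU1P[s0|s0].
  by rewrite (ge0_integral_gaussian_dirac _ f0 mf)// -s0.
by rewrite (ge0_integral_gaussian_normal _ f0 mf)// normal_moment2.
Qed.

Lemma gaussian_moment4_lty : (\int[P]_w (X w ^+ 4)%:E < +oo)%E.
Proof.
have mf : measurable_fun [set: R] (fun x : R => (x ^+ 4)%:E).
  by apply/measurable_EFinP; exact: measurable_funX.
have f0 (x : R) : (0 <= (x ^+ 4)%:E)%E by rewrite lee_fin (exprM x 2 2) sqr_ge0.
move: s_ge0; rewrite le_eqVlt => /predU1P[s0|s0].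
  by rewrite (ge0_integral_gaussian_dirac _ f0 mf)// ltry.
by rewrite (ge0_integral_gaussian_normal _ f0 mf)// normal_moment4_lty.
Qed.

(** The point mass at 0 is fixed by reflection, and for s > 0 the density is even. The vanishing of
    the mean rests on this symmetry. *)
Lemma gaussian_symmetric (f : R -> R) : (forall x, 0 <= f x) -> continuous f ->
  (\int[P]_w (f (X w))%:E = \int[P]_w (f (- X w))%:E)%E.
Proof.
move=> f0 cf.
have cfN : continuous (f \o -%R).
  by move=> x; apply: continuous_comp; [exact: oppr_continuous|exact: cf].
have mE (h : R -> R) : continuous h -> measurable_fun [set: R] (EFin \o h).
  by move=> ch; apply/measurable_EFinP; exact: continuous_measurable_fun.
have f0E x : (0 <= (EFin \o f) x)%E by rewrite lee_fin.
have f0NE x : (0 <= (EFin \o (f \o -%R)) x)%E by rewrite lee_fin/=.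
move: s_ge0; rewrite le_eqVlt => /predU1P[s0|s0].
  rewrite (ge0_integral_gaussian_dirac _ f0E (mE _ cf))//.
  by rewrite (ge0_integral_gaussian_dirac _ f0NE (mE _ cfN))//= oppr0.
have s_neq0 := lt0r_neq0 s0.
rewrite (ge0_integral_gaussian_normal _ f0E (mE _ cf))//.
rewrite (ge0_integral_gaussian_normal _ f0NE (mE _ cfN))//.
rewrite !ge0_integral_normal_prob//; [|exact: mE|exact: mE].
rewrite (ge0_integralTN (f := fun x => f x * normal_pdf 0 s x)).
- by apply: eq_integral => x _ /=; rewrite normal_pdfN.
- by move=> x; rewrite mulr_ge0// normal_pdf_ge0.
- by move=> x; apply: cvgM; [exact: cf|exact: continuous_normal_pdf].
Qed.

End gaussian_random_variable.

(** * Noise *)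

Section independent_product.
Local Open Scope ereal_scope.
Context {R : realType} d (T : measurableType d) (P : probability T R).

(** The joint law of (X, Y) agrees with the product of the marginal laws on rectangles, hence
    everywhere, and Fubini's theorem factors the integral. *)
Lemma integral_indepM (X Y : T -> R) :
    measurable_fun setT X -> measurable_fun setT Y ->
    (forall A B : set R, measurable A -> measurable B ->
      P (X @^-1` A `&` Y @^-1` B) = P (X @^-1` A) * P (Y @^-1` B)) ->
    P.-integrable setT (EFin \o X) -> P.-integrable setT (EFin \o Y) ->
    P.-integrable setT (EFin \o (X \* Y)%R) ->
  \int[P]_w (X w * Y w)%:E = \int[P]_w (X w)%:E * \int[P]_w (Y w)%:E.
Proof.
move=> mX mY indep iX iY iXY.
pose X' : {mfun T >-> R} := MeasurableFun.Pack
  (MeasurableFun.Class (isMeasurableFun.Build _ _ _ _ _ mX)).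
pose Y' : {mfun T >-> R} := MeasurableFun.Pack
  (MeasurableFun.Class (isMeasurableFun.Build _ _ _ _ _ mY)).
have mZ : measurable_fun setT (fun w => (X w, Y w)).
  exact: measurable_fun_pair.
pose Z' : {mfun T >-> (R * R)%type} := MeasurableFun.Pack
  (MeasurableFun.Class (isMeasurableFun.Build _ _ _ _ _ mZ)).
pose m1 := distribution P X'; pose m2 := distribution P Y'.
have mid : measurable_fun [set: R] (EFin : R -> \bar R).
  by apply/measurable_EFinP; exact: measurable_id.
have i1 : m1.-integrable setT EFin by exact: (integrable_pushforward mX).
have i2 : m2.-integrable setT EFin by exact: (integrable_pushforward mY).
have prodE A : measurable A -> (m1 \x m2) A = distribution P Z' A.
  apply: product_measure_unique => B C mB mC; rewrite -indep//.
pose f (z : R * R) := (z.1 * z.2)%:E.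
have mf : measurable_fun setT f.
  by apply/measurable_EFinP/measurable_funM;
    [exact: measurable_fst|exact: measurable_snd].
(* Fubini's theorem needs integrability under the product measure, which Tonelli's theorem derives
   from the finite absolute first moments. *)
have i12 : (m1 \x m2).-integrable setT f.
  apply/(integrable12ltyP _ _ mf).
  have mabs : measurable_fun [set: R] (fun x : R => `|x|%:E).
    by apply/measurable_EFinP; exact: normr_measurable.
  under eq_integral => x _.
    under eq_integral do rewrite /f/= normrM EFinM.
    rewrite ge0_integralZl_EFin//.
    over.
  rewrite /= ge0_integralZr//; last by apply: integral_ge0.
  have /integrableP[_ fin1] := i1; have /integrableP[_ fin2] := i2.
  rewrite lte_mul_pinfty//; first exact: integral_ge0.
  by rewrite ge0_fin_numE//; exact: integral_ge0.
rewrite -(integral_distribution (P := P) (X := Z') mf iXY).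
rewrite (eq_measure_integral (m1 \x m2)); last by move=> A mA _; exact/esym/prodE.
rewrite -integral12_prod_meas1//= /fubini_F.
under eq_integral => x _.
  under eq_integral do rewrite /f/= EFinM.
  rewrite integralZl//.
  over.
rewrite -(fineK (integrable_fin_num measurableT i2)).
rewrite integralZr//= fineK ?integrable_fin_num//.
by rewrite (integral_distribution (X := X') mid iX)
  (integral_distribution (X := Y') mid iY).
Qed.

End independent_product.

(** * First and second moments of the residual noise *)

Section noise.
Context {R : realType} d (T : measurableType d) (P : probability T R).

Lemma sqr_le_add1X4 (x : R) : x ^+ 2 <= 1 + x ^+ 4.
Proof. by have := sqr_ge0 (x ^+ 2 - 2^-1); nra. Qed.

Lemma normr_le_add1X4 (x : R) : `|x| <= 1 + x ^+ 4.
Proof.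
have x2 := sqr_ge0 (x ^+ 2 - 2^-1).
have := sqr_ge0 (x - 2^-1); have := sqr_ge0 (x + 2^-1).
by rewrite ler_norml => ? ?; apply/andP; split; nra.
Qed.

Lemma integral_probability_cst (x : R) : (\int[P]_w x%:E = x%:E)%E.
Proof. by rewrite integral_cst// [X in (_ * X)%E]probability_setT mule1. Qed.

(** The fourth moment depends on the law only, so one K serves all the noise variables at once; for
    s = 0 the law is a point mass at 0 and K = 0. *)
Lemma gaussian_moment4_bound (s : R) : 0 <= s -> exists K : R, 0 <= K /\
  forall X : {RV P >-> R},
    (forall B : set R, measurable B -> distribution P X B = gaussian 0 s B) ->
  (\int[P]_w (X w ^+ 4)%:E <= K%:E)%E.
Proof.
have mf : measurable_fun [set: R] (fun x : R => (x ^+ 4)%:E).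
  by apply/measurable_EFinP; exact: measurable_funX.
have f0 (x : R) : (0 <= (x ^+ 4)%:E)%E by rewrite lee_fin (exprM x 2 2) sqr_ge0.
rewrite le_eqVlt => /predU1P[s0|s0].
  exists 0; split => // X hX.
  by rewrite (ge0_integral_gaussian_dirac hX _ f0 mf)//= expr0n.
exists (fine (\int[normal_prob 0 s]_x (x ^+ 4)%:E)%E); split.
  by apply: fine_ge0; apply: integral_ge0.
move=> X hX; rewrite (ge0_integral_gaussian_normal hX _ f0 mf)// fineK//.
rewrite ge0_fin_numE.
  exact: normal_moment4_lty.
exact: integral_ge0.
Qed.

Lemma integrableM_of_sqr (X Y : T -> R) :
    measurable_fun setT X -> measurable_fun setT Y ->
    P.-integrable setT (EFin \o (fun w => X w ^+ 2)) ->
    P.-integrable setT (EFin \o (fun w => Y w ^+ 2)) ->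
  P.-integrable setT (EFin \o (X \* Y)).
Proof.
move=> mX mY iX2 iY2.
apply: (le_integrable measurableT _ _ (integrableD measurableT iX2 iY2)).
  by apply/measurable_EFinP; exact: measurable_funM.
move=> w _ /=; rewrite lee_fin [leRHS]ger0_norm ?addr_ge0 ?sqr_ge0//.
rewrite ler_norml; apply/andP; split.
  by have := sqr_ge0 (X w + Y w); nra.
by have := sqr_ge0 (X w - Y w); nra.
Qed.

Section one_variable.
Variables (X : {RV P >-> R}) (s : R).
Hypothesis s_ge0 : 0 <= s.
Hypothesis X_gauss : forall B : set R, measurable B ->
  distribution P X B = gaussian 0 s B.

(** The finite fourth moment dominates every function of at most quartic growth, which covers the
    residual noise and its square. *)
Lemma gaussian_integrable (f : R -> R) (K : R) : measurable_fun setT f ->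
    (forall x, `|f x| <= K * (1 + x ^+ 4)) ->
  P.-integrable setT (EFin \o (f \o X)).
Proof.
move=> mf fK.
have x4_ge0 (x : R) : 0 <= x ^+ 4 by rewrite (exprM x 2 2) sqr_ge0.
have iX4 : P.-integrable setT (EFin \o (fun w => X w ^+ 4)).
  apply/integrableP; split.
    by apply/measurable_EFinP; exact: measurable_funX.
  under eq_integral do rewrite /= ger0_norm//.
  exact: gaussian_moment4_lty s_ge0 X_gauss.
have i1 : P.-integrable setT (EFin \o cst 1).
  exact: finite_measure_integrable_cst.
have := integrableZl measurableT K (integrableD measurableT i1 iX4).
apply: le_integrable => //.
  by apply/measurable_EFinP; exact: measurableT_comp.
move=> w _ /=; rewrite lee_fin (le_trans (fK _))//.
exact: ler_norm.
Qed.

(** By symmetry of the law, the positive and negative parts have the same finite integral. *)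
Lemma gaussian_mean : (\int[P]_w (X w)%:E = 0)%E.
Proof.
have iX : P.-integrable setT (EFin \o X).
  apply: (@gaussian_integrable id 1) => [|x]; first exact: measurable_id.
  by rewrite mul1r normr_le_add1X4.
have max_cont : continuous (fun x : R => Num.max x 0).
  by move=> x; apply: continuous_max; [exact: cvg_id|exact: cvg_cst].
rewrite integralE.
have max_ge0 (x : R) : 0 <= Num.max x 0 by rewrite le_max lexx orbT.
have sym := gaussian_symmetric s_ge0 X_gauss max_ge0 max_cont.
have posE : (\int[P]_w ((EFin \o X)^\+ w) = \int[P]_w (Num.max (X w) 0)%:E)%E.
  by apply: eq_integral => w _; rewrite funeposE /= EFin_max.
have negE : (\int[P]_w ((EFin \o X)^\- w) = \int[P]_w (Num.max (- X w) 0)%:E)%E.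
  by apply: eq_integral => w _; rewrite funenegE /= EFin_max.
rewrite posE negE sym// subee//.
have iN : P.-integrable setT (EFin \o ((fun x => Num.max (- x) 0) \o X)).
  apply: (@gaussian_integrable _ 1) => [|x].
    apply: continuous_measurable_fun => x.
    by apply: continuous_max; [exact: oppr_continuous|exact: cvg_cst].
  rewrite mul1r (le_trans _ (normr_le_add1X4 x))// -(normrN x) /Num.max.
  by case: ltP => // _; rewrite normr0.
exact: integrable_fin_num iN.
Qed.

(** This is (c + x)^2 - c^2 - s^2, the centred error of a squared range measurement when c is the
    true distance. *)
Definition be_noise (c x : R) : R := 2 * c * x + x ^+ 2 - s ^+ 2.

Lemma measurable_be_noise (c : R) : measurable_fun setT (be_noise c).
Proof.
apply: measurable_funB => //; apply: measurable_funD.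
  by apply: measurable_funM => //; exact: measurable_funM.
exact: measurable_funX.
Qed.

Lemma integrable_be_noise (c : R) : P.-integrable setT (EFin \o (be_noise c \o X)).
Proof.
apply: (@gaussian_integrable _ (2 * `|c| + 1 + s ^+ 2)).
  exact: measurable_be_noise.
move=> x; rewrite /be_noise.
have x4 : 0 <= x ^+ 4 by rewrite (exprM x 2 2) sqr_ge0.
have x1 := normr_le_add1X4 x.
have x2 := sqr_le_add1X4 x.
have s2 := sqr_ge0 s.
rewrite (le_trans (ler_normB _ _))// (ger0_norm s2).
rewrite (le_trans (lerD (ler_normD _ _) (lexx _)))//.
rewrite (ger0_norm (sqr_ge0 x)) !normrM (@ger0_norm _ 2)//.
have := ler_wpM2l (normr_ge0 c) x1; nra.
Qed.

Lemma integrable_be_noise2 (c : R) :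
  P.-integrable setT (EFin \o (fun w => be_noise c (X w) ^+ 2)).
Proof.
apply: (@gaussian_integrable (fun x => be_noise c x ^+ 2)
  (8 * c ^+ 2 + 2 + 2 * s ^+ 4)).
  by apply: measurable_funX; exact: measurable_be_noise.
move=> x; rewrite ger0_norm ?sqr_ge0// /be_noise.
have x4 : 0 <= x ^+ 4 by rewrite (exprM x 2 2) sqr_ge0.
have x2 := sqr_le_add1X4 x.
have := ler_wpM2l (sqr_ge0 c) x2.
have := mulr_ge0 (sqr_ge0 (s ^+ 2)) x4.
have := sqr_ge0 (2 * c * x - (x ^+ 2 - s ^+ 2)).
have := mulr_ge0 (sqr_ge0 s) (sqr_ge0 x).
have := sqr_ge0 c; nra.
Qed.

Lemma mean_be_noise (c : R) : (\int[P]_w (be_noise c (X w))%:E = 0)%E.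
Proof.
have iX : P.-integrable setT (EFin \o X).
  apply: (@gaussian_integrable id 1) => [|x]; first exact: measurable_id.
  by rewrite mul1r normr_le_add1X4.
have iX2 : P.-integrable setT (EFin \o (fun w => X w ^+ 2)).
  apply: (@gaussian_integrable (fun x => x ^+ 2) 1) => [|x].
    exact: measurable_funX.
  by rewrite mul1r ger0_norm ?sqr_ge0// sqr_le_add1X4.
have iZ : P.-integrable setT (EFin \o (fun w => 2 * c * X w)).
  exact: (integrableZl measurableT (2 * c) iX).
rewrite /be_noise.
under eq_integral do rewrite EFinB.
rewrite integralB//; last exact: finite_measure_integrable_cst.
- under eq_integral do rewrite EFinD.
  rewrite integralD// (gaussian_moment2 s_ge0 X_gauss).
  under eq_integral do rewrite EFinM.
  rewrite integralZl// gaussian_mean mule0 add0e integral_probability_cst.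
  exact: subee.
exact: (integrableD measurableT iZ iX2).
Qed.

(** Put p = 2 c x and q = x^2 - s^2; then (p + q)^2 <= 2 p^2 + 2 q^2 and q^2 <= x^4 + s^4. *)
Lemma second_moment_be_noise (c K : R) : (\int[P]_w (X w ^+ 4)%:E <= K%:E)%E ->
  (\int[P]_w (be_noise c (X w) ^+ 2)%:E <=
   (8 * c ^+ 2 * s ^+ 2 + 2 * K + 2 * s ^+ 4)%:E)%E.
Proof.
move=> hK.
have mX2 : measurable_fun setT (fun w => (X w ^+ 2)%:E).
  by apply/measurable_EFinP; exact: measurable_funX.
have mX4 : measurable_fun setT (fun w => (X w ^+ 4)%:E).
  by apply/measurable_EFinP; exact: measurable_funX.
have x4 (x : R) : 0 <= x ^+ 4 by rewrite (exprM x 2 2) sqr_ge0.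
apply: (@le_trans _ _ (\int[P]_w ((8 * c ^+ 2)%:E * (X w ^+ 2)%:E +
    (2%:E * (X w ^+ 4)%:E + (2 * s ^+ 4)%:E)))%E).
  apply: ge0_le_integral => //.
  - by move=> w _; rewrite lee_fin sqr_ge0.
  - apply/measurable_EFinP; apply: measurable_funX.
    by apply: measurableT_comp => //; exact: measurable_be_noise.
  - apply: emeasurable_funD; first exact: measurable_funeM.
    by apply: emeasurable_funD => //; exact: measurable_funeM.
  move=> w _; rewrite -!EFinM -!EFinD lee_fin /be_noise.
  have := sqr_ge0 (2 * c * X w - (X w ^+ 2 - s ^+ 2)).
  have := mulr_ge0 (sqr_ge0 s) (sqr_ge0 (X w)); nra.
rewrite ge0_integralD//; last 4 first.
- by move=> w _; rewrite -EFinM lee_fin mulr_ge0 ?sqr_ge0// mulr_ge0 ?sqr_ge0.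
- exact: measurable_funeM.
- by move=> w _; rewrite -EFinM -EFinD lee_fin addr_ge0// mulr_ge0.
- by apply: emeasurable_funD => //; exact: measurable_funeM.
rewrite ge0_integralZl_EFin//; last 2 first.
- by move=> w _; rewrite lee_fin sqr_ge0.
- by rewrite mulr_ge0 ?sqr_ge0.
rewrite (gaussian_moment2 s_ge0 X_gauss).
rewrite ge0_integralD//; last 3 first.
- by move=> w _; rewrite -EFinM lee_fin mulr_ge0.
- exact: measurable_funeM.
- by move=> w _; rewrite lee_fin mulr_ge0.
rewrite ge0_integralZl_EFin//; last by move=> w _; rewrite lee_fin.
rewrite integral_probability_cst -addrA [leRHS]EFinD.
apply: leeD; first by rewrite EFinM.
rewrite [leRHS]EFinD; apply: leeD => //.
by rewrite [leRHS]EFinM lee_wpmul2l.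
Qed.

End one_variable.

(** Functions of two independent noises are independent, so the expectation of the product factors
    into two zero means. *)
Lemma be_noise_uncorrelated (r : nat -> {RV P >-> R}) (s : R) (c : nat -> R)
    (i k : nat) :
    0 <= s -> iid_gaussian r 0 s -> i != k ->
  (\int[P]_w (be_noise s (c i) (r i w) * be_noise s (c k) (r k w))%:E = 0)%E.
Proof.
move=> s0 [indep gauss] ik.
have mq j : measurable_fun setT (be_noise s (c j) \o r j).
  by apply: measurableT_comp => //; exact: measurable_be_noise.
have iq j := integrable_be_noise s0 (gauss j) (c j).
have iq2 j := integrable_be_noise2 s0 (gauss j) (c j).
rewrite (@integral_indepM _ _ _ _ _ _ (mq i) (mq k)) //.
- by rewrite (mean_be_noise s0 (gauss i)) mul0e.
- move=> A B mA mB.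
  (* Mutual independence takes a family of events indexed by all naturals; only its members at i and
     k are tested. *)
  pose C j := if j == i then be_noise s (c i) @^-1` A
              else be_noise s (c k) @^-1` B.
  have mC j : measurable (C j).
    by rewrite /C; case: ifP => _; rewrite -[X in measurable X]setTI;
      exact: measurable_be_noise.
  have uik : uniq [:: i; k] by rewrite /= inE ik.
  have := indep [:: i; k] C uik mC.
  rewrite big_cons big_seq1 /C eqxx [k == i]eq_sym (negbTE ik) => <-.
  congr (P _); apply/seteqP; split => w /=.
    move=> [wA wB] j /=; rewrite !inE => /orP[]/eqP ->.
      by rewrite eqxx.
    by rewrite eq_sym (negbTE ik).
  move=> h; split.
    by have := h i; rewrite /= !inE !eqxx; exact.
  by have := h k; rewrite /= !inE !eqxx orbT [k == i]eq_sym (negbTE ik); exact.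
- exact: integrableM_of_sqr (mq i) (mq k) (iq2 i) (iq2 k).
Qed.

Lemma integral_sqr_sum_uncorrelated (m : nat) (Y : nat -> T -> R) :
    (forall i, measurable_fun setT (Y i)) ->
    (forall i, P.-integrable setT (EFin \o (fun w => Y i w ^+ 2))) ->
    (forall i k, i != k -> \int[P]_w (Y i w * Y k w)%:E = 0)%E ->
  (\int[P]_w ((\sum_(i < m) Y i w) ^+ 2)%:E =
   \sum_(i < m) \int[P]_w (Y i w ^+ 2)%:E)%E.
Proof.
move=> mY iY2 orth.
have iYY i k : P.-integrable setT (fun w => (Y i w * Y k w)%:E).
  exact: integrableM_of_sqr.
have E w : ((\sum_(i < m) Y i w) ^+ 2)%:E =
    (\sum_(i < m) \sum_(k < m) (Y i w * Y k w)%:E)%E.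
  rewrite expr2 mulr_suml -sumEFin; apply: eq_bigr => i _.
  by rewrite mulr_sumr -sumEFin.
under eq_integral do rewrite E.
rewrite integral_sum//; last first.
  by move=> i; apply: integrable_sum => // k _; exact: iYY.
apply: eq_bigr => i _; rewrite integral_sum// (bigD1 i)//= big1 ?adde0//.
by move=> k ki; rewrite orth// eq_sym.
Qed.

End noise.

(** * Coercivity of the quadratic forms *)

Section coercivity.
Context {R : realType} (N : nat).

Definition dotv (n : nat) (u v : 'rV[R]_n) : R := \sum_j u 0 j * v 0 j.

Lemma dotvBl (n : nat) (u u' v : 'rV[R]_n) : dotv (u - u') v = dotv u v - dotv u' v.
Proof.
rewrite /dotv -sumrB; apply: eq_bigr => j _.
by rewrite !mxE mulrBl.
Qed.

Lemma dotvZl (n : nat) (k : R) (u v : 'rV[R]_n) : dotv (k *: u) v = k * dotv u v.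
Proof.
by rewrite /dotv mulr_sumr; apply: eq_bigr => j _; rewrite mxE mulrA.
Qed.

Lemma dotvC (n : nat) (u v : 'rV[R]_n) : dotv u v = dotv v u.
Proof. by apply: eq_bigr => j _; rewrite mulrC. Qed.

Lemma dotvv_ge0 (n : nat) (u : 'rV[R]_n) : 0 <= dotv u u.
Proof. by apply: sumr_ge0 => j _; rewrite -expr2 sqr_ge0. Qed.

Lemma sqr_coord_le_dotvv (n : nat) (u : 'rV[R]_n) j : u 0 j ^+ 2 <= dotv u u.
Proof.
rewrite /dotv (bigD1 j)//= -expr2 lerDl.
by apply: sumr_ge0 => k _; rewrite -expr2 sqr_ge0.
Qed.

Lemma dotvv_eq0 (n : nat) (u : 'rV[R]_n) : dotv u u = 0 -> u = 0.
Proof.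
move=> u0; apply/rowP => j; apply/eqP; rewrite mxE -sqrf_eq0 eq_le sqr_ge0 andbT.
by rewrite -u0 sqr_coord_le_dotvv.
Qed.

Lemma compact_unit_sphere : compact [set u : 'rV[R]_N | dotv u u = 1].
Proof.
apply: bounded_closed_compact.
  exists 1; split; first exact: num_real.
  move=> x x1 u /= u1; rewrite (le_trans _ (ltW x1))//.
  rewrite [leLHS]/Num.Def.normr/= mx_normrE; apply: bigmax_le => // -[i j] _ /=.
  have := sqr_coord_le_dotvv u j; rewrite u1 (ord1 i) ler_norml => uj.
  by apply/andP; split; nra.
apply: (@closed_comp _ _ (fun u : 'rV[R]_N => dotv u u) [set 1]).
  move=> u _; move: u; apply: continuous_big; first exact: add_continuous.
  move=> j _ u.
  exact: cvgM (@coord_continuous R _ _ 0 j u) (@coord_continuous R _ _ 0 j u).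
exact: closed_eq.
Qed.

Lemma normr_dotv_le (u v : 'rV[R]_N) (K e : R) :
    (forall j, `|v 0 j| <= K) -> (forall j, `|u 0 j| <= e) ->
  `|dotv u v| <= N%:R * (e * K).
Proof.
move=> vK ue; rewrite (le_trans (ler_norm_sum _ _ _))//.
rewrite -[X in X%:R * _]card_ord mulr_natl -sumr_const.
apply: ler_sum => j _; rewrite normrM.
by rewrite ler_pM.
Qed.

(** The hypothesis treats one direction at a time; compactness of the unit sphere makes the
    constants uniform, and homogeneity of degree two removes the normalisation of u. *)
Lemma sum_sqr_dotv_coercive (v : nat -> 'rV[R]_N) (K : R) :
    0 <= K -> (forall i j, `|v i 0 j| <= K) ->
    (forall u, dotv u u = 1 -> exists e rho : R, [/\ 0 < e, 0 < rho &
      \forall m \near \oo,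
        rho * m%:R <= #|[pred i : 'I_m | e <= `|dotv u (v i)|]|%:R]) ->
  exists (c : R) (M : nat), 0 < c /\ forall m u, (M <= m)%N ->
    c * m%:R * dotv u u <= \sum_(i < m) dotv u (v i) ^+ 2.
Proof.
move=> K0 vK hu.
have /compact_near_coveringP cover := compact_unit_sphere.
(* The constant c is a variable tending to 0 from the right while m tends to infinity, so that a
   single compactness argument produces both c and M. *)
pose F := filter_prod (0 : R)^'+ (\oo : set_system nat).
pose Q (p : R * nat) u := p.1 * p.2%:R <= \sum_(i < p.2) dotv u (v i) ^+ 2.
have : \forall p \near F, [set u | dotv u u = 1] `<=` Q p.
  apply: cover => u /= u1.
  have [e [rho [e0 rho0 hm]]] := hu u u1.
  (* A change of at most del in each coordinate of u moves u.v_i by at most e/2; the added ones keep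
     the denominator positive when N or K is 0. *)
  pose del := e / (2 * (N%:R + 1) * (K + 1)).
  have delP : N%:R * (del * K) <= e / 2.
    have NK : N%:R * K <= (N%:R + 1) * (K + 1) by apply: ler_pM => //; lra.
    have NK0 : 0 < (N%:R + 1) * (K + 1) by rewrite mulr_gt0// ltr_wpDl.
    have -> : N%:R * (del * K) =
        e / 2 * (N%:R * K / ((N%:R + 1) * (K + 1))).
      rewrite /del; field; rewrite !gt_eqF// ltr_wpDl//.
    by rewrite ler_piMr ?divr_ge0 ?(ltW e0)// ler_pdivrMr// mul1r.
  have del0 : 0 < del.
    by rewrite divr_gt0// !mulr_gt0// ltr_wpDl.
  have nearu : \forall u' \near u, forall i, `|dotv u' (v i) - dotv u (v i)| <= e / 2.
    near=> u'; move=> i; rewrite -dotvBl.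
    apply: (le_trans (@normr_dotv_le _ _ K del (vK i) _)).
      move=> j; rewrite !mxE distrC.
      have : ball u del u' by near: u'; exact: nbhsx_ballx.
      by move=> [_ /(_ 0 j)]; exact: ltW.
    exact: delP.
  pose c0 := rho * (e / 2) ^+ 2.
  have c0_gt0 : 0 < c0 by rewrite mulr_gt0// exprn_gt0// divr_gt0.
  have nearc : \forall c \near (0 : R)^'+, c <= c0 by exact: nbhs_right_le.
  exists ([set u' | forall i, `|dotv u' (v i) - dotv u (v i)| <= e / 2],
     [set p | p.1 <= c0 /\
       rho * p.2%:R <= #|[pred i : 'I_p.2 | e <= `|dotv u (v i)|]|%:R]) => /=.
    split => //.
    exists ([set c | c <= c0], [set m : nat |
      rho * m%:R <= #|[pred i : 'I_m | e <= `|dotv u (v i)|]|%:R]) => //.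
  move=> [u' [c m]] /= [hu' [cc0 hcard]].
  rewrite /Q/=.
  (* Sensors with |u.v_i| >= e still satisfy |u'.v_i| >= e/2; their terms alone contribute at least
     rho m (e/2)^2. *)
  pose S := [pred i : 'I_m | e <= `|dotv u (v i)|].
  apply: (@le_trans _ _ (\sum_(i < m | S i) (e / 2) ^+ 2)).
    rewrite sumr_const -[leRHS]mulr_natr.
    apply: (@le_trans _ _ (c0 * m%:R)); first by rewrite ler_wpM2r.
    by rewrite /c0 mulrAC [leRHS]mulrC ler_wpM2r ?sqr_ge0.
  rewrite [leRHS](bigID S)/= -[leLHS]addr0; apply: lerD; last first.
    by apply: sumr_ge0 => i _; exact: sqr_ge0.
  apply: ler_sum => i /= Si.
  rewrite -[leRHS](real_normK (num_real _)) ler_sqr ?nnegrE//;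
    last by rewrite divr_ge0 ?ltW.
  have := hu' i.
  have := ler_normD (dotv u' (v i)) (dotv u (v i) - dotv u' (v i)).
  rewrite distrC addrC subrK => h1 h2; lra.
case=> -[A B] /= [hA hB] hAB.
have [c [Ac c0]] : exists c, A c /\ 0 < c.
  have : \forall c \near (0 : R)^'+, A c /\ 0 < c.
    by near=> c; split; near: c => //; exact: nbhs_right_gt.
  by move/filter_ex => [c hc]; exists c.
have [M _ hM] := hB.
exists c, M; split => // m u Mm.
have [u0|u_neq0] := eqVneq (dotv u u) 0.
  by rewrite u0 mulr0 sumr_ge0// => i _; rewrite sqr_ge0.
have u_gt0 : 0 < dotv u u by rewrite lt_neqAle eq_sym u_neq0 dotvv_ge0.
pose t := Num.sqrt (dotv u u).
have t_gt0 : 0 < t by rewrite sqrtr_gt0.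
have t2 : t ^+ 2 = dotv u u by rewrite sqr_sqrtr ?dotvv_ge0.
have := hAB (c, m) (conj Ac (hM m Mm)) (t^-1 *: u).
rewrite /Q /= dotvZl dotvC dotvZl mulrA -t2.
have -> : t^-1 * t^-1 * t ^+ 2 = 1 by field; rewrite gt_eqF.
move=> /(_ erefl) h.
apply: (@le_trans _ _ ((\sum_(i < m) dotv (t^-1 *: u) (v i) ^+ 2) * t ^+ 2)).
  by rewrite ler_wpM2r ?sqr_ge0.
rewrite mulr_suml; apply: ler_sum => i _; rewrite dotvZl.
by rewrite exprMn exprVn mulrAC mulVf ?mul1r// sqrf_eq0 gt_eqF.
Unshelve. all: by end_near. Qed.

End coercivity.

(** * Boxes and distribution functions *)

Lemma negligible_bigcup_countType d (T : measurableType d) (R : realType)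
    (mu : {measure set T -> \bar R}) (I : countType) (F : I -> set T) :
  (forall i, mu.-negligible (F i)) -> mu.-negligible (\bigcup_i F i).
Proof.
move=> F0; pose G k := if unpickle k is Some i then F i else set0.
have -> : \bigcup_i F i = \bigcup_k G k.
  apply/seteqP; split => x /= [i _].
    by move=> Fx; exists (pickle i) => //; rewrite /G pickleK.
  by rewrite /G; case: unpickle => [j|//] Fx; exists j.
apply: negligible_bigcup => k; rewrite /G; case: unpickle => [j|] //.
exact: negligible_set0.
Qed.

Section boxes.
Context {R : realType} (n : nat) (mu : probability (borelRV R n) R).
Implicit Types y z b c : 'rV[R]_n.

Lemma open_measurable_rV (U : set 'rV[R]_n) : open U ->
  measurable (U : set (borelRV R n)).
Proof. by move=> oU; exact: sub_sigma_algebra. Qed.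

Lemma measurable_coord (j : 'I_n) :
  measurable_fun setT (fun y : borelRV R n => (y : 'rV[R]_n) 0 j).
Proof.
apply: (measurability _ (RGenOInfty.measurableE R)) => _ [_ [x ->] <-].
rewrite setTI; apply: open_measurable_rV.
apply: open_comp; last exact: interval_open.
by move=> y _; exact: coord_continuous.
Qed.

Lemma measurable_coord_le (z : 'rV[R]_n) :
  measurable ([set y : 'rV[R]_n | coord_le y z] : set (borelRV R n)).
Proof.
have -> : [set y : 'rV[R]_n | coord_le y z] =
    \bigcap_(j in [set: 'I_n]) ((fun y : 'rV[R]_n => y 0 j) @^-1` `]-oo, z 0 j]).
  apply/seteqP; split => y /=.
    by move=> /forallP yz j _ /=; rewrite in_itv/=.
  by move=> yz; apply/forallP => j; have := yz j I; rewrite /= in_itv.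
apply: fin_bigcap_measurable; first exact: finite_finset.
move=> j _; rewrite -[X in measurable X]setTI.
exact: measurable_coord.
Qed.

Definition nonatom (j : 'I_n) (t : R) :=
  mu [set y : 'rV[R]_n | y 0 j = t] = 0%E.

(** The atoms of a marginal are countably many, hence Lebesgue-null, whereas an open interval has
    positive length. *)
Lemma exists_nonatom (j : 'I_n) (x y : R) : x < y ->
  exists2 t, x < t < y & nonatom j t.
Proof.
move=> xy; apply/not_exists2P => h.
pose X : {RV mu >-> R} := MeasurableFun.Pack
  (MeasurableFun.Class (isMeasurableFun.Build _ _ _ _ _ (measurable_coord j))).
have sub : `]x, y[%classic `<=` [set t : R | 0 < pmf X t].
  move=> t /=; rewrite in_itv/= => txy.
  have := h t; rewrite txy/= => -[//|] /eqP mut.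
  rewrite /pmf fine_gt0// lt0e mut measure_ge0/= ltey_eq.
  by rewrite fin_num_measure// -[X in measurable X]setTI; exact: measurable_coord.
have := countable_lebesgue_measure0
  (sub_countable (subset_card_le sub) (pmf_gt0_countable X)).
rewrite lebesgue_measure_itv/= lte_fin xy => /eqP.
by rewrite -EFinD eqe subr_eq0 gt_eqF.
Qed.

Lemma measurable_coord_preimage (j : 'I_n) (B : set R) : measurable B ->
  measurable ([set y : 'rV[R]_n | B (y 0 j)] : set (borelRV R n)).
Proof.
by move=> mB; rewrite -[X in measurable X]setTI; exact: (measurable_coord j).
Qed.

Lemma fine_measure_le_add (A B D : set (borelRV R n)) :
    measurable A -> measurable B -> measurable D -> A `<=` B `|` D ->
  fine (mu A) <= fine (mu B) + fine (mu D).
Proof.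
move=> mA mB mD AB; rewrite -lee_fin EFinD !fineK ?fin_num_measure//.
apply: (@le_trans _ _ (mu (B `|` D))).
  by apply: le_measure => //; rewrite inE//; exact: measurableU.
exact: measureU2.
Qed.

(** The lower orthants at [z] and at a point within 1/(k+1) of [z] differ only inside this set. *)
Let slab (z : 'rV[R]_n) (k : nat) : set (borelRV R n) :=
  [set y : 'rV[R]_n | exists j, `|y 0 j - z 0 j| <= k.+1%:R^-1].

Let measurable_slab z k : measurable (slab z k).
Proof.
have -> : slab z k = \bigcup_(j in [set: 'I_n])
    [set y : 'rV[R]_n | `[z 0 j - k.+1%:R^-1, z 0 j + k.+1%:R^-1]%classic (y 0 j)].
  apply/seteqP; split => y /=.
    by move=> [j yj]; exists j => //=; rewrite in_itv/= -ler_distl.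
  by move=> [j _ /=]; rewrite in_itv/= -ler_distl => yj; exists j.
apply: fin_bigcup_measurable; first exact: finite_finset.
by move=> j _; exact: measurable_coord_preimage.
Qed.

(** The slabs decrease to the union of the n hyperplanes y_j = z_j, each of measure zero; continuity
    from above concludes. *)
Let slab_cvg0 z : (forall j, nonatom j (z 0 j)) ->
  mu (slab z k) @[k --> \oo] --> (0 : \bar R)%E.
Proof.
move=> zna.
have m1 j : measurable ([set y : 'rV[R]_n | y 0 j = z 0 j] : set (borelRV R n)).
  exact: (measurable_coord_preimage j (measurable_set1 (z 0 j))).
have cap0 : mu (\bigcap_k slab z k) = 0%E.
  apply/negligibleP; first by apply: bigcap_measurable => // k _.
  have : mu.-negligible (\bigcup_j [set y : 'rV[R]_n | y 0 j = z 0 j]).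
    by apply: negligible_bigcup_countType => j; apply/negligibleP => //; exact: zna.
  apply: negligibleS => y ycap; apply: contrapT => ynot.
  have /choice[k hk] : forall j, exists k, k.+1%:R^-1 < `|y 0 j - z 0 j|.
    move=> j; have : 0 < `|y 0 j - z 0 j|.
      by rewrite normr_gt0 subr_eq0; apply/eqP => yz; apply: ynot; exists j.
    by move=> /ltr_add_invr[k]; rewrite add0r; exists k.
  (* There are finitely many coordinates, so the slab of index the largest of the k_j already misses
     y. *)
  have [j] := ycap (\max_j k j)%N I.
  apply/negP; rewrite -ltNge (le_lt_trans _ (hk j))// lef_pV2 ?posrE//.
  by rewrite ler_nat ltnS leq_bigmax.
rewrite -cap0; apply: nonincreasing_cvg_mu.
- by rewrite -ge0_fin_numE// fin_num_measure//; exact: measurable_slab.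
- by move=> k; exact: measurable_slab.
- by apply: bigcap_measurable => // k _; exact: measurable_slab.
- move=> k l kl; apply/subsetPset => y [j yj]; exists j.
  by rewrite (le_trans yj)// lef_pV2 ?posrE// ler_nat ltnS.
Qed.

(** Near [z] the distribution function varies by at most the measure of a slab, which can be made
    arbitrarily small. *)
Lemma continuous_dist_fun z : (forall j, nonatom j (z 0 j)) ->
  {for z, continuous (dist_fun mu)}.
Proof.
move=> /slab_cvg0 z0.
apply/(@cvgrPdist_le _ _ _ (nbhs z) (nbhs_filter z)) => e e0.
have /fine_cvgP[_ fz0] := z0.
have [k /ltW fe] := filter_ex (cvgr_lt _ fz0 e e0).
near=> z'.
have zz' j : `|z 0 j - z' 0 j| < k.+1%:R^-1.
  have : ball z k.+1%:R^-1 z' by near: z'; exact: nbhsx_ballx.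
  by move=> [_ /(_ 0 j)].
(* One inclusion serves both sides of the estimate, since either argument may be z, the centre of
   the slab. *)
have sub (x y : 'rV[R]_n) :
    (forall j, `|x 0 j - y 0 j| < k.+1%:R^-1) -> (x = z \/ y = z) ->
    [set t : 'rV[R]_n | coord_le t x] `<=`
      [set t : 'rV[R]_n | coord_le t y] `|` slab z k.
  move=> xy xyz t /= tx.
  have [ty|nty] := boolP (coord_le t y); [by left|right; move: nty].
  rewrite /coord_le negb_forall => /existsP[j]; rewrite -ltNge => yt.
  have {}tx := forallP tx j; exists j.
  have := xy j; rewrite ltr_distl => /andP[h1 h2].
  rewrite ler_distl; set e1 := k.+1%:R^-1 in h1 h2 *.
  move: tx yt h1 h2 => /= tx yt h1 h2.
  case: xyz => <-; apply/andP; split; lra.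
have mle := measurable_coord_le.
suff : (`|dist_fun mu z - dist_fun mu z'| <= e :> R) by [].
rewrite ler_distl; apply/andP; split.
  rewrite lerBlDr (le_trans (fine_measure_le_add (mle z') (mle z)
    (measurable_slab z k) (sub z' z _ _)))//.
  - by move=> j; rewrite distrC.
  - by right.
  - by rewrite lerD2l.
rewrite (le_trans (fine_measure_le_add (mle z) (mle z')
  (measurable_slab z k) (sub z z' _ _)))//.
- by left.
- by rewrite lerD2l.
Unshelve. all: by end_near. Qed.

End boxes.

(** * Half-open boxes and limiting frequencies *)

Section boxes.
Context {R : realType} (n : nat).
Implicit Types y z b c : 'rV[R]_n.

(** Open at [c] and closed at [b], so that the indicator is exactly a signed sum of indicators of
    lower orthants. *)
Definition box b c y : bool := [forall j, (c 0 j < y 0 j) && (y 0 j <= b 0 j)].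

Definition corner b c (f : {ffun 'I_n -> bool}) : 'rV[R]_n :=
  \row_j (if f j then c 0 j else b 0 j).

(** This is -1 to the number of coordinates that the corner takes from [c]. *)
Definition corner_sign (f : {ffun 'I_n -> bool}) : R :=
  \prod_j (if f j then -1 else 1).

Lemma prodr_nat_bool (p : pred 'I_n) :
  \prod_j (p j)%:R = [forall j, p j]%:R :> R.
Proof.
have [/forallP h|/forallPn[j /negbTE pj]] := boolP [forall j, p j].
  by apply: big1 => j _; rewrite h.
by rewrite (bigD1 j)//= pj mul0r.
Qed.

(** Each coordinate contributes the indicator of y_j <= b_j minus that of y_j <= c_j; the product of
    these differences is expanded over all choices of one term per coordinate. *)
Lemma box_inclusion_exclusion b c y : (forall j, c 0 j <= b 0 j) ->
  (box b c y)%:R = \sum_f corner_sign f * (coord_le y (corner b c f))%:R :> R.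
Proof.
move=> cb; rewrite /box -prodr_nat_bool.
pose G j (e : bool) : R := (if e then -1 else 1) *
  (y 0 j <= (if e then c 0 j else b 0 j))%R%:R.
transitivity (\prod_j \sum_e G j e).
  apply: eq_bigr => j _; rewrite big_bool /G /= mulN1r mul1r.
  have := cb j; case: (leP (y 0 j) (c 0 j)) => [yc cbj|cy _] /=.
    by rewrite (le_trans yc cbj) addNr.
  by rewrite oppr0 add0r.
rewrite bigA_distr_bigA; apply: eq_bigr => f _.
rewrite /coord_le -prodr_nat_bool -big_split/=; apply: eq_bigr => j _.
by rewrite mxE.
Qed.

Lemma card_pred_sum (a : nat -> 'rV[R]_n) (m : nat) (p : 'rV[R]_n -> bool) :
  #|[pred i : 'I_m | p (a i)]|%:R = \sum_(i < m) (p (a i))%:R :> R.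
Proof.
rewrite -sum1_card natr_sum big_mkcond; apply: eq_bigr => i _.
by rewrite inE; case: p.
Qed.

Variable mu : probability (borelRV R n) R.

Lemma measurable_box b c : measurable ([set y | box b c y] : set (borelRV R n)).
Proof.
have -> : [set y | box b c y] = \bigcap_(j in [set: 'I_n])
    [set y : 'rV[R]_n | `]c 0 j, b 0 j]%classic (y 0 j)].
  apply/seteqP; split => y /=.
    by move=> /forallP yz j _ /=; rewrite in_itv/=.
  by move=> yz; apply/forallP => j; have := yz j I; rewrite /= in_itv.
apply: fin_bigcap_measurable; first exact: finite_finset.
by move=> j _; exact: measurable_coord_preimage.
Qed.

Lemma integral_nat_bool (p : 'rV[R]_n -> bool) :
    measurable ([set y | p y] : set (borelRV R n)) ->
  (\int[mu]_y ((p y)%:R)%:E = mu [set y | p y])%E.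
Proof.
move=> mp; rewrite -[in RHS](setIT [set y | p y]) -integral_indic//.
by apply: eq_integral => y _; rewrite indicE mem_setE.
Qed.

Lemma measure_box b c : (forall j, c 0 j <= b 0 j) ->
  fine (mu [set y | box b c y]) =
  \sum_f corner_sign f * dist_fun mu (corner b c f).
Proof.
move=> cb; rewrite -integral_nat_bool; last exact: measurable_box.
have mle z := measurable_coord_le z.
have ile z : mu.-integrable setT (fun y => ((coord_le y z)%:R : R)%:E).
  apply/integrableP; split.
    have -> : (fun y : borelRV R n => ((coord_le y z)%:R : R)%:E) =
        EFin \o \1_([set y | coord_le y z] : set (borelRV R n)).
      by apply/funext => y; rewrite /= indicE mem_setE.
    by apply/measurable_EFinP; exact: measurable_indic.
  under eq_integral do rewrite /= normr_nat.
  by rewrite integral_nat_bool// ltey_eq fin_num_measure.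
under eq_integral do rewrite box_inclusion_exclusion// -sumEFin.
rewrite integral_sum//; last first.
  move=> f; exact: (integrableZl measurableT (corner_sign f) (ile (corner b c f))).
rewrite (eq_bigr (fun f => (corner_sign f * dist_fun mu (corner b c f))%:E)).
  by rewrite sumEFin.
move=> f _; under eq_integral do rewrite EFinM.
rewrite integralZl// integral_nat_bool// EFinM /dist_fun fineK//.
exact: fin_num_measure.
Qed.

(** The inclusion-exclusion identity is averaged over the sensors. Every coordinate of a corner
    comes from [b] or [c] and avoids the atoms, so each corner is a continuity point and the
    finitely many terms converge. *)
Lemma box_frequency_cvg (a : nat -> 'rV[R]_n) b c :
    (forall z, {for z, continuous (dist_fun mu)} ->
      sample_df a m z @[m --> \oo] --> dist_fun mu z) ->
    (forall j, c 0 j <= b 0 j) ->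
    (forall j, nonatom mu j (b 0 j)) -> (forall j, nonatom mu j (c 0 j)) ->
  (#|[pred i : 'I_m | box b c (a i)]|%:R / m%:R : R) @[m --> \oo] -->
  fine (mu [set y | box b c y]).
Proof.
move=> A3 cb nb nc; rewrite measure_box//.
have -> : (fun m => #|[pred i : 'I_m | box b c (a i)]|%:R / m%:R : R) =
    (fun m => \sum_f corner_sign f * sample_df a m (corner b c f)).
  apply/funext => m; rewrite card_pred_sum.
  under eq_bigr do rewrite box_inclusion_exclusion//.
  rewrite exchange_big mulr_suml; apply: eq_bigr => f _ /=.
  by rewrite -mulr_sumr -mulrA /sample_df
    (card_pred_sum a m (fun y => coord_le y (corner b c f))).
apply: cvg_big; first exact: add_continuous.
move=> f _; apply: cvgM; first exact: cvg_cst.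
apply: A3; apply: continuous_dist_fun => j.
by rewrite mxE; case: (f j).
Qed.

(** Countably many rational cubes whose doubles lie in [O] cover [O], so one of them is charged; the
    gap between this cube and its double leaves room for faces that avoid the atoms. *)
Lemma open_contains_box (O : set 'rV[R]_n) : open O ->
    (0 < mu (O : set (borelRV R n)))%E ->
  exists b c, [/\ forall j, c 0 j <= b 0 j, forall j, nonatom mu j (b 0 j),
    forall j, nonatom mu j (c 0 j), [set y | box b c y] `<=` O &
    0 < fine (mu [set y | box b c y])].
Proof.
move=> oO muO.
(* The pair p encodes a rational centre and a scale 1/(p.2+1); t = 1 gives the cube and t = 2 its
   double. *)
pose B (p : 'rV[rat]_n * nat) (t : R) : set (borelRV R n) :=
  [set y : 'rV[R]_n | forall j, `|y 0 j - ratr (p.1 0 j)| < t / p.2.+1%:R].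
pose G p := if `[< B p 2 `<=` O >] then B p 1 else set0.
have mB p t : measurable (B p t).
  have -> : B p t = \bigcap_(j in [set: 'I_n])
      [set y : 'rV[R]_n | `]ratr (p.1 0 j) - t / p.2.+1%:R,
                           ratr (p.1 0 j) + t / p.2.+1%:R[%classic (y 0 j)].
    apply/seteqP; split => y /=.
      by move=> yp j _ /=; rewrite in_itv/= -ltr_distl.
    by move=> yp j; have := yp j I; rewrite /= in_itv/= -ltr_distl.
  apply: fin_bigcap_measurable; first exact: finite_finset.
  by move=> j _; exact: measurable_coord_preimage.
have [p [pO mup]] : exists p, B p 2 `<=` O /\ (0 < mu (B p 1%R))%E.
  apply: contrapT => nop; suff : mu (O : set (borelRV R n)) = 0%E.
    by move=> muO0; rewrite muO0 ltxx in muO.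
  apply: measure_negligible; first exact: open_measurable_rV.
  have : mu.-negligible (\bigcup_p G p).
    apply: negligible_bigcup_countType => p; rewrite /G; case: asboolP => pO.
      apply/negligibleP => //; apply/eqP; rewrite eq_le measure_ge0 andbT leNgt.
      by apply/negP => mup; apply: nop; exists p.
    exact: negligible_set0.
  apply: negligibleS => y Oy.
  have [e /= e0 eO] := (nbhs_ballP y O).1 (open_nbhs_nbhs (conj oO Oy)).
  (* With 3/(k+1) < e and a rational centre within 1/(k+1) of y, the doubled cube stays within e of
     y. *)
  have [k] := ltr_add_invr (divr_gt0 e0 (ltr0n R 3)).
  rewrite add0r => ke.
  have k0 : 0 < k.+1%:R^-1 :> R by rewrite invr_gt0.
  have /choice[q hq] : forall j : 'I_n, exists q : rat,
      `|y 0 j - ratr q| < k.+1%:R^-1.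
    move=> j; have [|q] := @rat_in_itvoo R (y 0 j - k.+1%:R^-1) (y 0 j + k.+1%:R^-1).
      by rewrite ltrBlDr -addrA ltrDl addr_gt0.
    by rewrite in_itv/= => qy; exists q; rewrite distrC ltr_distl.
  exists (\row_j q j, k) => //; rewrite /G asboolT.
    by move=> j; rewrite mxE div1r.
  move=> t /= tq; apply: eO; split => // i j; rewrite (ord1 i) /ball/=.
  have := tq j; rewrite mxE => tqj.
  rewrite (le_lt_trans (ler_distD (ratr (q j)) _ _))//.
  rewrite [X in _ + X]distrC; have := hq j.
  by move: tqj ke; rewrite /=; set dl := k.+1%:R^-1; lra.
pose dl : R := p.2.+1%:R^-1.
have dl0 : 0 < dl by rewrite invr_gt0.
have /choice[b hb] : forall j, exists t, nonatom mu j t /\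
    ratr (p.1 0 j) + dl < t < ratr (p.1 0 j) + 2 * dl.
  move=> j; have [|t ht nt] := @exists_nonatom R n mu j
    (ratr (p.1 0 j) + dl) (ratr (p.1 0 j) + 2 * dl); last by exists t.
  by rewrite ltrD2l; lra.
have /choice[c hc] : forall j, exists t, nonatom mu j t /\
    ratr (p.1 0 j) - 2 * dl < t < ratr (p.1 0 j) - dl.
  move=> j; have [|t ht nt] := @exists_nonatom R n mu j
    (ratr (p.1 0 j) - 2 * dl) (ratr (p.1 0 j) - dl); last by exists t.
  by lra.
exists (\row_j b j), (\row_j c j); split.
- move=> j; rewrite !mxE.
  have [_ /andP[h1 h2]] := hb j; have [_ /andP[h3 h4]] := hc j; lra.
- by move=> j; rewrite mxE; case: (hb j).
- by move=> j; rewrite mxE; case: (hc j).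
- move=> y /= /forallP ybc; apply: pO => j; have := ybc j; rewrite !mxE.
  have [_ /andP[h1 h2]] := hb j; have [_ /andP[h3 h4]] := hc j.
  by move=> /andP[h5 h6]; rewrite ltr_distl /= -/dl; apply/andP; split; lra.
- apply: fine_gt0; apply/andP; split; last first.
    by rewrite ltey_eq fin_num_measure//; exact: measurable_box.
  apply: (lt_le_trans mup); apply: le_measure; rewrite ?inE//.
    exact: measurable_box.
  move=> y /= yp; apply/forallP => j; rewrite !mxE.
  have [_ /andP[h1 h2]] := hb j; have [_ /andP[h3 h4]] := hc j.
  by have := yp j; rewrite ltr_distl /= -/dl => /andP[h5 h6]; apply/andP; split; lra.
Qed.

End boxes.

(** * Sensors off a hyperplane *)

Section homogeneous_coordinates.
Context {R : realType} (n : nat).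
Implicit Types x y z h : 'rV[R]_n.

(** Homogeneous coordinates of [y] centred at [x]: an affine function of [y] becomes a linear form,
    the pairing with a fixed vector. *)
Definition homog x y : 'rV[R]_(1 + n) := row_mx (const_mx 1) (y - x).

Lemma dotv_row_mx (m : nat) (s t : 'rV[R]_m) h z :
  dotv (row_mx s h) (row_mx t z) = dotv s t + dotv h z.
Proof.
rewrite /dotv big_split_ord/=; congr (_ + _); apply: eq_bigr => j _.
  by rewrite !row_mxEl.
by rewrite !row_mxEr.
Qed.

Lemma dotv_const_mx (s t : R) :
  dotv (const_mx s : 'rV[R]_1) (const_mx t : 'rV[R]_1) = s * t.
Proof. by rewrite /dotv big_ord1 !mxE. Qed.

Lemma dotv_homog (s : R) h x y :
  dotv (row_mx (const_mx s) h) (homog x y) = s + dotv h (y - x).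
Proof. by rewrite dotv_row_mx dotv_const_mx mulr1. Qed.

Lemma continuous_dotv (f g : 'rV[R]_n -> 'rV[R]_n) :
    (forall j, continuous (fun y => f y 0 j)) ->
    (forall j, continuous (fun y => g y 0 j)) ->
  continuous (fun y => dotv (f y) (g y)).
Proof.
move=> cf cg; apply: continuous_big; first exact: add_continuous.
by move=> j _ y; exact: cvgM (cf j y) (cg j y).
Qed.

Lemma continuous_coordB x j : continuous (fun y : 'rV[R]_n => (y - x) 0 j).
Proof.
have -> : (fun y : 'rV[R]_n => (y - x) 0 j) = (fun y : 'rV[R]_n => y 0 j - x 0 j).
  by apply/funext => y; rewrite !mxE.
move=> y; exact: cvgB (@coord_continuous R _ _ 0 j y) (cvg_cst _).
Qed.

Lemma continuous_dotv_homog (u : 'rV[R]_(1 + n)) x :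
  continuous (fun y => dotv u (homog x y)).
Proof.
have -> : (fun y => dotv u (homog x y)) =
    (fun y => lsubmx u 0 0 + dotv (rsubmx u) (y - x)).
  apply/funext => y; rewrite -[in LHS](hsubmxK u).
  rewrite (_ : lsubmx u = const_mx (lsubmx u 0 0)) ?dotv_homog ?mxE//.
  by apply/rowP => j; rewrite (ord1 j) !mxE.
have cdot : continuous (fun y => dotv (rsubmx u) (y - x)).
  apply: (@continuous_dotv (fun=> rsubmx u) (fun y => y - x)) => j.
    exact: cst_continuous.
  exact: continuous_coordB.
by move=> y; exact: cvgD (cvg_cst _) (cdot y).
Qed.

(** The point x - (s / h.h) h solves the equation, and the directions orthogonal to h form the
    kernel of its transpose, of dimension n - 1. *)
Lemma affine_flat_dotv_homog (s : R) h x : h != 0 ->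
  affine_flat n.-1 [set y | dotv (row_mx (const_mx s) h) (homog x y) = 0].
Proof.
move=> h0; exists (x - (s / dotv h h) *: h), (kermx h^T); split.
  by rewrite mxrank_ker mxrank_tr rank_rV h0 subn1.
have hh0 : dotv h h != 0 by apply: contra h0 => /eqP/dotvv_eq0 ->.
have mulE z : z *m h^T = const_mx (dotv z h).
  apply/rowP => j; rewrite !mxE; apply: eq_bigr => k _.
  by rewrite !mxE (ord1 j).
have dotE y : dotv (y - (x - (s / dotv h h) *: h)) h = s + dotv h (y - x).
  rewrite opprB addrCA addrC -[_ *: h]opprK -scaleNr dotvBl dotvZl dotvC.
  by rewrite mulNr opprK divfK//; exact: addrC.
apply/seteqP; split => y /=; rewrite dotv_homog -dotE.
  by move=> sy; apply/sub_kermxP; rewrite mulE sy; apply/rowP => j; rewrite !mxE.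
by move=> /sub_kermxP; rewrite mulE => /rowP/(_ 0); rewrite !mxE.
Qed.

Variable mu : probability (borelRV R n) R.
Hypothesis mu_flat : forall S, affine_flat n.-1 S -> mu S <> 1%E.

Lemma measurable_dotv_homog_neq0 (u : 'rV[R]_(1 + n)) x :
  measurable ([set y | dotv u (homog x y) != 0] : set (borelRV R n)).
Proof.
apply: open_measurable_rV.
apply: (@open_comp _ _ (fun y => dotv u (homog x y)) [set t | t != 0]).
  by move=> y _; exact: continuous_dotv_homog.
exact: open_neq.
Qed.

(** Otherwise the zero set would have measure one. It is an excluded flat when the linear part of u
    is non-zero, and empty when only the constant part is. *)
Lemma measure_dotv_homog_neq0 (u : 'rV[R]_(1 + n)) x : u != 0 ->
  (0 < mu ([set y | dotv u (homog x y) != 0%R] : set (borelRV R n)))%E.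
Proof.
move=> u0; rewrite lt0e measure_ge0 andbT; apply/eqP => mu0.
pose Z : set (borelRV R n) := [set y | dotv u (homog x y) = 0].
have ZC : ~` Z = [set y | dotv u (homog x y) != 0].
  by apply/seteqP; split => y /= /eqP.
have mZC : measurable (~` Z) by rewrite ZC; exact: measurable_dotv_homog_neq0.
have mZ : measurable Z by rewrite -(setCK Z); exact: measurableC.
have muZ : mu Z = 1%E.
  have := probability_setC mu mZC; rewrite setCK ZC => ->.
  by rewrite mu0 sube0.
have uE : u = row_mx (const_mx (lsubmx u 0 0)) (rsubmx u).
  rewrite -[LHS](hsubmxK u); congr row_mx.
  by apply/rowP => j; rewrite (ord1 j) !mxE.
have [h0|h0] := eqVneq (rsubmx u) 0; last first.
  by apply: (mu_flat (S := Z)) => //; rewrite /Z uE; exact: affine_flat_dotv_homog.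
have s0 : lsubmx u 0 0 != 0.
  apply: contra u0 => /eqP s0; rewrite uE s0 h0.
  have -> : const_mx 0 = 0 :> 'rV[R]_1 by apply/rowP => j; rewrite !mxE.
  by rewrite row_mx0.
have Z0 : Z = set0.
  apply/seteqP; split => // y; rewrite /Z/= uE dotv_homog h0.
  rewrite /dotv big1 ?addr0; first by move=> /eqP; rewrite (negbTE s0).
  by move=> j _; rewrite mxE mul0r.
by move: muZ; rewrite Z0 measure0 => /eqP; rewrite eqe eq_sym oner_eq0.
Qed.

Lemma frequency_dotv_homog (a : nat -> 'rV[R]_n) (u : 'rV[R]_(1 + n)) x :
    (forall z, {for z, continuous (dist_fun mu)} ->
      sample_df a m z @[m --> \oo] --> dist_fun mu z) ->
    u != 0 ->
  exists e rho : R, [/\ 0 < e, 0 < rho &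
    \forall m \near \oo, rho * m%:R <=
      #|[pred i : 'I_m | e <= `|dotv u (homog x (a i))|]|%:R].
Proof.
move=> A3 u0.
pose O (k : nat) : set (borelRV R n) :=
  [set y | k.+1%:R^-1 < `|dotv u (homog x y)|].
have oO k : open (O k : set 'rV[R]_n).
  apply: (@open_comp _ _ (fun y => `|dotv u (homog x y)|) [set t | k.+1%:R^-1 < t]).
    move=> y _; apply: (@continuous_comp _ _ _ (fun y => dotv u (homog x y)) Num.norm).
      exact: continuous_dotv_homog.
    exact: norm_continuous.
  exact: open_gt.
(* The sets O k exhaust the charged set where the affine function does not vanish, so one of them is
   charged. *)
have [k muO] : exists k, (0 < mu (O k))%E.
  apply: contrapT => nok.
  have := measure_dotv_homog_neq0 x u0; apply/negP; rewrite -leNgt.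
  have negl : mu.-negligible (\bigcup_k O k).
    apply: negligible_bigcup => k; apply/negligibleP.
      exact: open_measurable_rV.
    apply/eqP; rewrite eq_le measure_ge0 andbT leNgt.
    by apply/negP => muO; apply: nok; exists k.
  have : mu.-negligible ([set y | dotv u (homog x y) != 0] : set (borelRV R n)).
    apply: negligibleS negl => y /=; rewrite -normr_gt0 => /ltr_add_invr[k].
    by rewrite add0r => yk; exists k.
  move=> /(measure_negligible (measurable_dotv_homog_neq0 u x)) ->.
  exact: lexx.
have [b [c [cb nb nc bO mub]]] := open_contains_box (oO k) muO.
(* Half of the limiting frequency of a charged box inside O k is exceeded from some m on. *)
exists k.+1%:R^-1, (fine (mu [set y | box b c y]) / 2); split.
- by rewrite invr_gt0.
- by rewrite divr_gt0.
have := box_frequency_cvg A3 cb nb nc.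
move=> /cvgr_gt /(_ (fine (mu [set y | box b c y]) / 2)).
rewrite ltr_pdivrMr// ltr_pMr// ltr1n => /(_ isT).
apply: filterS => m.
(* At m = 0 the frequency is a division by zero, but the claim is trivial there. *)
have [->|m0] := eqVneq m 0%N; first by rewrite mulr0.
rewrite ltr_pdivlMr ?ltr0n ?lt0n// => /ltW/le_trans; apply.
rewrite ler_nat; apply: subset_leq_card; apply/fintype.subsetP => i.
by rewrite !inE => /bO /ltW.
Qed.

End homogeneous_coordinates.

(** * The Bias-Eli estimator *)

Section bias_eli.
Context {R : realType} (n : nat).
Implicit Types x y z h : 'rV[R]_n.

Lemma sqr_enorm x : enorm x ^+ 2 = dotv x x.
Proof.
rewrite /enorm sqr_sqrtr; first by apply: eq_bigr => j _; rewrite expr2.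
by apply: sumr_ge0 => j _; exact: sqr_ge0.
Qed.

Lemma enorm_ge0 x : 0 <= enorm x. Proof. exact: sqrtr_ge0. Qed.

Lemma dotvBB (m : nat) (u v : 'rV[R]_m) :
  dotv (u - v) (u - v) = dotv u u - 2 * dotv u v + dotv v v.
Proof.
rewrite dotvBl dotvC dotvBl [X in _ - X]dotvC dotvBl (dotvC v u).
ring.
Qed.

(** Expanding around x0, the term |y - x0|^2 cancels against the squared range. With h = x - x0, the
    residual is affine in the lifted vector (|h|^2, -2 h), although quadratic in h. *)
Lemma be_residual_homog x0 x y (s rho : R) :
  enorm (y - x) ^+ 2 - (enorm (y - x0) + rho) ^+ 2 + s ^+ 2 =
  dotv (row_mx (const_mx (dotv (x - x0) (x - x0))) (- 2 *: (x - x0))) (homog x0 y)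
  - be_noise s (enorm (y - x0)) rho.
Proof.
have -> : y - x = (y - x0) - (x - x0).
  by rewrite opprB addrA subrK.
rewrite dotv_homog dotvZl sqr_enorm dotvBB sqrrD sqr_enorm /be_noise.
rewrite (dotvC (x - x0) (y - x0)); ring.
Qed.

Lemma dotv_suml (m N : nat) (c : nat -> R) (v : nat -> 'rV[R]_N) (u : 'rV[R]_N) :
  dotv u (\sum_(i < m) c i *: v i) = \sum_(i < m) c i * dotv u (v i).
Proof.
rewrite /dotv; under eq_bigr do rewrite summxE mulr_sumr.
rewrite exchange_big; apply: eq_bigr => i _ /=; rewrite mulr_sumr.
by apply: eq_bigr => j _; rewrite mxE mulrCA.
Qed.

(** Only the comparison with the competitor u = 0 is made; it gives k |u|^2 <= 2 u.W. Positivity of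
    |k u - 2 W|^2 then stands in for the Cauchy-Schwarz inequality. *)
Lemma least_squares_minimizer_bound (m N : nat) (v : nat -> 'rV[R]_N)
    (noise : nat -> R) (u : 'rV[R]_N) (k : R) :
    0 <= k -> k * dotv u u <= \sum_(i < m) dotv u (v i) ^+ 2 ->
    \sum_(i < m) (dotv u (v i) - noise i) ^+ 2 <= \sum_(i < m) noise i ^+ 2 ->
  k ^+ 2 * dotv u u <=
    4 * dotv (\sum_(i < m) noise i *: v i) (\sum_(i < m) noise i *: v i).
Proof.
move=> k0 hk hmin; set W := \sum_(i < m) _.
have uW : \sum_(i < m) dotv u (v i) ^+ 2 <= 2 * dotv u W.
  have E : \sum_(i < m) (dotv u (v i) - noise i) ^+ 2 =
      \sum_(i < m) dotv u (v i) ^+ 2 - 2 * dotv u W + \sum_(i < m) noise i ^+ 2.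
    rewrite /W dotv_suml mulr_sumr -sumrB -big_split /=.
    by apply: eq_bigr => i _; ring.
  by move: hmin; rewrite E; lra.
have := dotvv_ge0 (k *: u - 2 *: W).
rewrite dotvBB !dotvZl (dotvC u (k *: u)) dotvZl (dotvC u (2 *: W)) dotvZl.
rewrite (dotvC W (2 *: W)) dotvZl (dotvC W u).
have := ler_wpM2l k0 (le_trans hk uW).
lra.
Qed.

Lemma normr_coord_le x j : `|x 0 j| <= `|x|.
Proof.
rewrite [leRHS]/Num.Def.normr/= mx_normrE.
by apply/bigmax_geP; right; exists (0, j).
Qed.

Lemma bounded_homog (a : nat -> 'rV[R]_n) (A : set 'rV[R]_n) x :
    bounded_set A -> (forall i, A (a i)) ->
  exists K : R, 0 <= K /\ forall i j, `|homog x (a i) 0 j| <= K.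
Proof.
move=> [M [Mreal AM]] aA.
exists (1 + `|M| + 1 + `|x|); split; first by rewrite !addr_ge0.
move=> i j; rewrite /homog mxE; case: fintype.split => k; rewrite !mxE.
  rewrite normr1 -!addrA lerDl !addr_ge0//.
have ai : `|a i| <= `|M| + 1.
  by apply: (AM _ _ _ (aA i)); rewrite (le_lt_trans (ler_norm M))// ltrDl.
rewrite (le_trans (ler_normB _ _))// lerD// ?normr_coord_le//.
rewrite (le_trans (normr_coord_le _ _))// (le_trans ai)// -addrA lerDr.
exact: ler01.
Qed.

End bias_eli.

(** * Second moment of the weighted noise sum *)

Section noise_vector.
Context {R : realType} d (T : measurableType d) (P : probability T R).
Variables (r : nat -> {RV P >-> R}) (s : R).
Hypothesis s_ge0 : 0 <= s.
Hypothesis r_iid : iid_gaussian r 0 s.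
Variables (N : nat) (v : nat -> 'rV[R]_N) (c : nat -> R).

Definition noise_vector (m : nat) (w : T) : 'rV[R]_N :=
  \sum_(i < m) be_noise s (c i) (r i w) *: v i.

Let coordE m w j : noise_vector m w 0 j =
  \sum_(i < m) be_noise s (c i) (r i w) * v i 0 j.
Proof. by rewrite /noise_vector summxE; apply: eq_bigr => i _; rewrite mxE. Qed.

Let mterm j i : measurable_fun setT (fun w => be_noise s (c i) (r i w) * v i 0 j).
Proof.
apply: measurable_funM => //; apply: measurableT_comp => //.
exact: measurable_be_noise.
Qed.

Lemma measurable_dotv_noise_vector m :
  measurable_fun setT (fun w => dotv (noise_vector m w) (noise_vector m w)).
Proof.
apply: measurable_sum => j.
have mj : measurable_fun setT (fun w => noise_vector m w 0 j).
  by under eq_fun do rewrite coordE; exact: measurable_sum.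
exact: measurable_funM.
Qed.

(** Each coordinate is a sum of m uncorrelated terms with uniformly bounded second moments, so its
    second moment grows only linearly in m; this is the source of the rate sqrt m. *)
Lemma second_moment_noise_vector (K Kc : R) :
    (forall i j, `|v i 0 j| <= K) -> (forall i, `|c i| <= Kc) ->
  exists C : R, 0 <= C /\ forall m,
    (\int[P]_w (dotv (noise_vector m w) (noise_vector m w))%:E <= (C * m%:R)%:E)%E.
Proof.
move=> vK cK; have [K4 [K40 hK4]] := gaussian_moment4_bound P s_ge0.
have [_ gauss] := r_iid.
pose C0 := 8 * Kc ^+ 2 * s ^+ 2 + 2 * K4 + 2 * s ^+ 4.
have s4 : 0 <= s ^+ 4 by exact: exprn_ge0.
have C00 : 0 <= C0.
  apply: addr_ge0; last exact: mulr_ge0.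
  apply: addr_ge0; last exact: mulr_ge0.
  by rewrite mulr_ge0 ?sqr_ge0// mulr_ge0 ?sqr_ge0.
exists (N%:R * (K ^+ 2 * C0)); split.
  by rewrite mulr_ge0// mulr_ge0// sqr_ge0.
move=> m.
have coord j : (\int[P]_w ((noise_vector m w 0 j) ^+ 2)%:E <=
    (m%:R * (K ^+ 2 * C0))%:E)%E.
  under eq_integral do rewrite coordE.
  rewrite (integral_sqr_sum_uncorrelated m (mterm j)).
  - apply: (@le_trans _ _ (\sum_(i < m) (K ^+ 2 * C0)%:E)%E).
      apply: lee_sum => i _.
      under eq_integral do rewrite exprMn mulrC EFinM.
      rewrite ge0_integralZl_EFin//; last 3 first.
      + by move=> w _; rewrite lee_fin sqr_ge0.
      + apply/measurable_EFinP/measurable_funX; apply: measurableT_comp => //.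
        exact: measurable_be_noise.
      + exact: sqr_ge0.
      apply: (@le_trans _ _ ((v i 0 j ^+ 2)%:E * C0%:E)%E).
        apply: lee_wpmul2l; first by rewrite lee_fin sqr_ge0.
        apply: (le_trans (second_moment_be_noise s_ge0 (gauss i) (c i)
          (hK4 _ (gauss i)))).
        rewrite lee_fin /C0 !lerD2r -[c i ^+ 2]real_normK ?num_real//.
        rewrite ler_wpM2r ?sqr_ge0// ler_wpM2l// ler_sqr ?nnegrE//.
        exact: le_trans (cK i).
      rewrite -EFinM lee_fin ler_wpM2r// -[v i 0 j ^+ 2]real_normK ?num_real//.
      by rewrite ler_sqr ?nnegrE//; exact: le_trans (vK i j).
    by rewrite sumEFin lee_fin sumr_const card_ord mulr_natl.
  - move=> i; under [X in _.-integrable _ X]eq_fun do rewrite exprMn mulrC EFinM.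
    exact: (integrableZl measurableT _ (integrable_be_noise2 s_ge0 (gauss i) (c i))).
  - move=> i k ik.
    under eq_integral do rewrite mulrACA mulrC EFinM.
    have mq l : measurable_fun setT (fun w => be_noise s (c l) (r l w)).
      by apply: measurableT_comp => //; exact: measurable_be_noise.
    have iq2 l := integrable_be_noise2 s_ge0 (gauss l) (c l).
    rewrite integralZl//.
      by rewrite (be_noise_uncorrelated c s_ge0 r_iid ik) mule0.
    exact: integrableM_of_sqr (mq i) (mq k) (iq2 i) (iq2 k).
rewrite /dotv; under eq_integral do rewrite -sumEFin.
rewrite ge0_integral_sum//; last 2 first.
- move=> j; apply/measurable_EFinP; rewrite -[X in measurable_fun _ X]/(fun w => _).
  by apply: measurable_funM; under eq_fun do rewrite coordE; exact: measurable_sum.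
- by move=> j w _; rewrite lee_fin -expr2 sqr_ge0.
apply: (@le_trans _ _ (\sum_(j < N) (m%:R * (K ^+ 2 * C0))%:E)%E).
  by apply: lee_sum => j _; under eq_integral do rewrite -expr2; exact: coord.
by rewrite sumEFin lee_fin sumr_const card_ord -[leLHS]mulr_natl
  [m%:R * _]mulrC !mulrA.
Qed.

End noise_vector.

(** * Pathwise error bound and Markov's inequality for the estimator *)

Theorem theorem3 (R : realType) (n : nat) (hn : n = 2%N \/ n = 3%N)
  (disp : measure_display) (T : measurableType disp) (P : probability T R)
  (* object, sensor positions, noise, range measurements *)
  (xo : 'rV[R]_n) (a : nat -> 'rV[R]_n)
  (r : nat -> {RV P >-> R}) (sigma : R)
  (d : nat -> T -> R)
  (hd : forall i w, d i w = enorm (a i - xo) + r i w)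
  (* (A1) *)
  (hsigma : 0 <= sigma)
  (A1 : iid_gaussian r 0 sigma)
  (* (A2) *)
  (X A : set 'rV[R]_n)
  (hX : compact X) (hxo : X^° xo)
  (hA : bounded_set A) (haA : forall i, A (a i)) (haX : forall i, ~ X (a i))
  (* (A3) *)
  (mu : probability (borelRV R n) R)
  (A3 : forall z : 'rV[R]_n, {for z, continuous (dist_fun mu)} ->
     sample_df a m z @[m --> \oo] --> dist_fun mu z)
  (* (A6) *)
  (A6_line : n = 2%N ->
     ~ exists S : set 'rV[R]_n, affine_flat 1 S /\ mu S = 1%E)
  (A6_plane : n = 3%N ->
     ~ exists S : set 'rV[R]_n, affine_flat 2 S /\ mu S = 1%E)
  (* Bias-Eli estimates *)
  (xBE : nat -> {RV P >-> borelRV R n})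
  (hBE : forall (m : nat) (w : T) (x : 'rV[R]_n),
     be_cost a (d ^~ w) sigma m (xBE m w) <= be_cost a (d ^~ w) sigma m x) :
  bigO_p P (fun m w => (xBE m w : 'rV[R]_n) - xo)
    (fun m => (Num.sqrt (m%:R : R))^-1).
Proof.
(* In both dimensions the excluded flats are the hyperplanes, of dimension n - 1. *)
have mu_flat S : affine_flat n.-1 S -> mu S <> 1%E.
  move=> flatS muS; case: hn => n_eq.
    by apply: (A6_line n_eq); exists S; split => //; rewrite -[1%N]/(2.-1) -n_eq.
  by apply: (A6_plane n_eq); exists S; split => //; rewrite -[2%N]/(3.-1) -n_eq.
pose v i := homog xo (a i).
pose c i := enorm (a i - xo).
have [K [K0 vK]] := bounded_homog xo hA haA.
have [k [M [k0 hk]]] : exists (k : R) (M : nat), 0 < k /\ forall m u, (M <= m)%N ->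
    k * m%:R * dotv u u <= \sum_(i < m) dotv u (v i) ^+ 2.
  apply: (sum_sqr_dotv_coercive K0 vK) => u u1.
  apply: (frequency_dotv_homog mu_flat xo A3).
  apply: contra_eqN u1 => /eqP ->.
  rewrite /dotv big1 ?(eq_sym 0) ?oner_eq0// => j _.
  by rewrite mxE mul0r.
(* The entries of a_i - xo are among those of v_i, and c_i <= 1 + c_i^2. *)
have cK i : `|c i| <= 1 + n%:R * K ^+ 2.
  have c0 : 0 <= c i := enorm_ge0 _.
  rewrite ger0_norm//.
  have : c i ^+ 2 <= n%:R * K ^+ 2.
    rewrite /c sqr_enorm /dotv.
    apply: (@le_trans _ _ (\sum_(j < n) K ^+ 2)).
      apply: ler_sum => j _; rewrite -expr2.
      have := vK i (rshift 1 j); rewrite /v /homog row_mxEr => eK.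
      by rewrite -real_normK ?num_real// ler_sqr ?nnegrE.
    by rewrite sumr_const card_ord mulr_natl.
  have := sqr_ge0 (c i - 1); nra.
have [C [C0 hC]] := second_moment_noise_vector hsigma A1 vK cK.
pose W := noise_vector r sigma v c.
have bound m w : (M <= m)%N ->
    (k * m%:R) ^+ 2 * dotv ((xBE m w : 'rV[R]_n) - xo) ((xBE m w : 'rV[R]_n) - xo)
      <= dotv (W m w) (W m w).
  move=> Mm; set h := (_ : 'rV[R]_n) - xo.
  pose noise i := be_noise sigma (c i) (r i w).
  pose u : 'rV[R]_(1 + n) := row_mx (const_mx (dotv h h)) (- 2 *: h).
  have km0 : 0 <= k * m%:R by rewrite mulr_ge0// ltW.
  (* The competitor is xo, whose residuals are the negated noise terms. *)
  have cost : \sum_(i < m) (dotv u (v i) - noise i) ^+ 2 <=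
      \sum_(i < m) noise i ^+ 2.
    have := hBE m w xo; rewrite /be_cost.
    under eq_bigr do rewrite hd be_residual_homog.
    congr (_ <= _); apply: eq_bigr => i _.
    by rewrite hd /noise /be_noise -/(c i); ring.
  have := least_squares_minimizer_bound km0 (hk m u Mm) cost.
  rewrite -/(noise_vector r sigma v c m w) dotv_row_mx dotv_const_mx.
  rewrite dotvZl dotvC dotvZl => hu.
  (* Here |u|^2 = |h|^4 + 4 |h|^2; the quartic term is dropped, and the factor 4 cancels the one in
     the least squares bound. *)
  have := mulr_ge0 (sqr_ge0 (k * m%:R)) (sqr_ge0 (dotv h h)).
  rewrite /W; nra.
(* This s satisfies C = k^2 eps s^2. The threshold s + 1 makes Markov's bound eps s^2 / (s + 1)^2
   strictly smaller than eps, also when C = 0. *)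
move=> eps eps0; set s := Num.sqrt (C / (k ^+ 2 * eps)).
have k2eps : 0 < k ^+ 2 * eps by rewrite mulr_gt0// exprn_gt0.
have s0 : 0 <= s by exact: sqrtr_ge0.
have Cs : C = k ^+ 2 * eps * s ^+ 2.
  rewrite sqr_sqrtr ?divr_ge0 ?(ltW k2eps)// mulrC divfK//.
  by rewrite gt_eqF.
exists M, (s + 1) => m Mm.
(* The strict inequality M < m excludes m = 0, where the rescaling would degenerate. *)
have m0 : 0 < m%:R :> R by rewrite ltr0n (leq_ltn_trans _ Mm).
have E w : (s + 1 < enorm ((Num.sqrt m%:R)^-1^-1 *: ((xBE m w : 'rV[R]_n) - xo))) =
    ((s + 1) ^+ 2 <
      m%:R * dotv ((xBE m w : 'rV[R]_n) - xo) ((xBE m w : 'rV[R]_n) - xo)).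
  rewrite invrK -ltr_sqr ?nnegrE ?enorm_ge0 ?addr_ge0// sqr_enorm.
  by rewrite dotvZl dotvC dotvZl mulrA -expr2 sqr_sqrtr// ltW.
(* The level for |W|^2: if sqrt m |h| exceeds s + 1, then (k m)^2 |h|^2 exceeds t. *)
pose t := k ^+ 2 * m%:R * (s + 1) ^+ 2.
have t0 : 0 < t by rewrite !mulr_gt0 ?exprn_gt0// ltr_wpDl.
pose WW w := (dotv (W m w) (W m w))%:E.
have mWW : measurable_fun setT WW.
  by apply/measurable_EFinP; exact: measurable_dotv_noise_vector.
have markov : (t%:E * P (setT `&` [set w | (t%:E <= `|WW w|)%E]) <= (C * m%:R)%:E)%E.
  apply: (@le_trans _ _ (\int[P]_w `|WW w|)%E).
    by apply: (@le_integral_comp_abse _ _ _ P setT measurableT WW t id).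
  under eq_integral do rewrite gee0_abs ?lee_fin ?dotvv_ge0//.
  exact: hC.
set B := [set w | _ < _].
(* The event is the preimage of an open set under the random vector [xBE m]. *)
have mB : measurable B.
  pose U := [set y : 'rV[R]_n | (s + 1) ^+ 2 < m%:R * dotv (y - xo) (y - xo)].
  have oU : open U.
    apply: (@open_comp _ _ (fun y : 'rV[R]_n => m%:R * dotv (y - xo) (y - xo))
      [set x | (s + 1) ^+ 2 < x]); last exact: open_gt.
    have cdot : continuous (fun y : 'rV[R]_n => dotv (y - xo) (y - xo)).
      by apply: (@continuous_dotv _ _ (fun y => y - xo) (fun y => y - xo)) => j;
        exact: continuous_coordB.
    by move=> y _; exact: cvgM (cvg_cst _) (cdot y).
  have -> : B = setT `&` xBE m @^-1` U.
    by rewrite setTI; apply/seteqP; split => w; rewrite /B /U /= E.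
  exact: (measurable_funPT (xBE m)) measurableT _ (open_measurable_rV oU).
have BW : B `<=` setT `&` [set w | (t%:E <= `|WW w|)%E].
  move=> w; rewrite /B/= E => hw; split => //=.
  rewrite lee_fin ger0_norm ?dotvv_ge0//.
  apply: le_trans (bound m w (ltnW Mm)).
  set hh := dotv _ _ in hw *; rewrite -subr_ge0.
  have -> : (k * m%:R) ^+ 2 * hh - t = k ^+ 2 * m%:R * (m%:R * hh - (s + 1) ^+ 2).
    by rewrite /t; ring.
  by apply: mulr_ge0; [rewrite mulr_ge0 ?sqr_ge0// ltW|rewrite subr_ge0 ltW].
rewrite ltNge; apply/negP => epsB.
(* Divided by k^2 eps m, this inequality reads (s + 1)^2 <= s^2, which is absurd. *)
have : (t%:E * eps%:E <= (C * m%:R)%:E)%E.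
  apply: le_trans markov; apply: lee_wpmul2l; first by rewrite lee_fin ltW.
  apply: (le_trans epsB); apply: le_measure; rewrite ?inE//.
  by apply: emeasurable_fun_c_infty => //; exact: measurableT_comp.
rewrite -EFinM lee_fin Cs /t leNgt => /negP; apply.
have -> : k ^+ 2 * eps * s ^+ 2 * m%:R = k ^+ 2 * eps * m%:R * s ^+ 2 by ring.
have -> : k ^+ 2 * m%:R * (s + 1) ^+ 2 * eps = k ^+ 2 * eps * m%:R * (s + 1) ^+ 2.
  by ring.
by rewrite ltr_pM2l ?mulr_gt0 ?exprn_gt0// ltr_sqr ?nnegrE ?addr_ge0// ltrDl.
Qed.
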